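(* Let $\varphi,\psi\colon\mathbb{D}\to\mathbb{D}$ be analytic and let $\alpha\in\mathbb{T}$. Put \[Z=\{\zeta\in\mathbb{T}:\ 0<\tau_{\varphi,\alpha}(\{\zeta\})\neq\tau_{\psi,\alpha}(\{\zeta\})\}.\] Then $\|C_\varphi-C_\psi\|_e^2\ \ge\ \tau_{\varphi,\alpha}(Z)$, where $\|\cdot\|_e$ is the essential norm of an operator on $\mathcal{H}^2$.
   Context: $\mathbb{D}$ is the open unit disc, $\mathbb{T}=\partial\mathbb{D}$, $m$ normalized Lebesgue measure on $\mathbb{T}$, $P_z(\zeta)=(1-|z|^2)/|\zeta-z|^2$. For analytic $\varphi\colon\mathbb{D}\to\mathbb{D}$ and $\alpha\in\mathbb{T}$, the Aleksandrov–Clark measure $\tau_{\varphi,\alpha}$ is the unique positive Borel measure on $\mathbb{T}$ with $\operatorname{Re}\frac{\alpha+\varphi(z)}{\alpha-\varphi(z)}=\frac{1-|\varphi(z)|^2}{|\alpha-\varphi(z)|^2}=\int_{\mathbb{T}}P_z\,d\tau_{\varphi,\alpha}$ for $z\in\mathbb{D}$. $C_\varphi f=f\circ\varphi$ on the Hardy space $\mathcal{H}^2$; the essential norm $\|T\|_e$ is the distance in operator norm from $T$ to the compact operators on $\mathcal{H}^2$. *)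

(* Defs.v *)
From mathcomp Require Import all_boot all_order all_algebra.
From mathcomp Require Import all_classical all_reals all_analysis.
From mathcomp Require Import complex.
Import Order.TTheory GRing.Theory Num.Theory.
Import numFieldNormedType.Exports.

Set Implicit Arguments.
Unset Strict Implicit.
Unset Printing Implicit Defensive.

Local Open Scope classical_set_scope.
Local Open Scope ring_scope.

Section HardyDefs.
Variable R : realType.

Definition cnorm (z : R[i]) : R :=
  let: (a +i* b)%C := z in Num.sqrt (a ^+ 2 + b ^+ 2).

Definition expi (t : R) : R[i] := (cos t +i* sin t)%C.

Definition inD (z : R[i]) : Prop := cnorm z < 1.

Definition analytic_on_D (f : R[i] -> R[i]) : Prop :=
  exists a : nat -> R[i], forall z, inD z ->
    (fun n : nat => cnorm (\sum_(k < n) a k * z ^+ k - f z)) @ \oo --> (0 : R).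

Definition analytic_selfmap (phi : R[i] -> R[i]) : Prop :=
  analytic_on_D phi /\ forall z, inD z -> inD (phi z).

Definition H2norm2 (f : R[i] -> R[i]) : \bar R :=
  ereal_sup [set (((2 * pi)^-1)%:E *
      \int[lebesgue_measure]_(t in `[0%R, (2 * pi)%R]) ((cnorm (f (r%:C%C * expi t))) ^+ 2)%:E)%E
    | r in `[(0:R), (1:R)[ ].

Definition is_H2 (f : R[i] -> R[i]) : Prop := analytic_on_D f /\ (H2norm2 f < +oo)%E.

Definition H2norm (f : R[i] -> R[i]) : R := Num.sqrt (fine (H2norm2 f)).

Definition op := (R[i] -> R[i]) -> (R[i] -> R[i]).

Definition opnorm (T : op) : \bar R :=
  ereal_sup [set (H2norm (T f))%:E | f in [set f | is_H2 f /\ H2norm f <= 1]].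

Definition compact_op (K : op) : Prop :=
  [/\ (forall f, is_H2 f -> is_H2 (K f)),
      (forall (f g : R[i] -> R[i]) (c : R[i]), is_H2 f -> is_H2 g ->
         forall z, inD z -> K (fun w => f w + c * g w) z = K f z + c * K g z)
    & (forall fs : nat -> (R[i] -> R[i]),
         (forall n, is_H2 (fs n) /\ H2norm (fs n) <= 1) ->
         exists sigma : nat -> nat, (forall n, (sigma n < sigma n.+1)%N) /\
           exists g, is_H2 g /\
             (fun k : nat => H2norm (fun w => K (fs (sigma k)) w - g w)) @ \oo --> (0 : R))].

Definition ess_norm (T : op) : \bar R :=
  ereal_inf [set opnorm (fun f w => T f w - K f w) | K in compact_op].

Definition comp_op (phi : R[i] -> R[i]) : op := fun f => f \o phi.

Definition poisson (z : R[i]) (t : R) : R :=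
  (1 - cnorm z ^+ 2) / cnorm (expi t - z) ^+ 2.

(* mu (a measure on R supported in [0,2pi), the circle T parametrized by
   t |-> e^{it}) is the Aleksandrov-Clark measure tau_{phi,alpha} *)
Definition is_clark_measure (phi : R[i] -> R[i]) (alpha : R[i])
    (mu : {measure set R -> \bar R}) : Prop :=
  mu (~` `[0%R, (2 * pi)%R[) = 0%E /\
  forall z, inD z ->
    (\int[mu]_(t in `[0%R, (2 * pi)%R[) (poisson z t)%:E)%E =
      ((1 - cnorm (phi z) ^+ 2) / cnorm (alpha - phi z) ^+ 2)%:E.

End HardyDefs.

(* Main.v *)
(* Test the operator on (truncations of) normalized reproducing kernels [f_w] with [w -> alpha]
   along a line in a Stolz angle, [w = alpha (1 - eps kappa)] with [kappa = 1 + i M], and pair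
   the result with the normalized kernels at [z_i = zeta_i (1 - c_i eps kappa)], where
   [c_i] is the mass of [tau_phi] at finitely many points [zeta_i] of [Z]. The kernels at the
   [z_i] are asymptotically orthonormal and a compact perturbation is negligible, so Bessel's
   inequality bounds the essential norm from below by the limits of [gap z_i * T f_w (z_i)].

   The limits come from the Clark measures. Since [1 / (1 - conj alpha phi)] and the Cauchy
   transform of [tau_phi] have the same real part up to a constant, they differ by a constant,
   and dominated convergence gives [(1 - conj zeta z) / (1 - conj alpha phi z) ->
   tau_phi {zeta}] nontangentially. Hence [phi] contributes [sqrt c_i], whereas [psi], whose
   mass at [zeta_i] is [d_i <> c_i], contributes a quantity of order [1 / M]; let [M] tend to
   infinity. *)
Require Import Defs.
From mathcomp Require Import all_boot all_order all_algebra.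
From mathcomp Require Import all_classical all_reals all_analysis.
From mathcomp Require Import measurable_realfun complex.
From mathcomp Require Import ring lra.
Import Order.TTheory GRing.Theory Num.Theory.
Import numFieldNormedType.Exports.
Local Open Scope classical_set_scope.
Local Open Scope ring_scope.

Set Implicit Arguments.
Unset Strict Implicit.
Unset Printing Implicit Defensive.

(** Why the points [z_i] are tuned to the masses: put [rho = tau {zeta_i} / c_i], where [tau] is the
    Clark measure of the map in question. Then [eps / (1 - conj w phi z_i)] tends to
    [rho / (conj kappa rho + kappa)]. At [rho = 1] the denominator is [2 Re kappa = 2], whatever [M]
    is; otherwise its imaginary part is [M (1 - rho)], so a steep slope suppresses every mass other
    than [c_i]. A radial approach ([M = 0]) would leave [rho / (1 + rho)]. Why the kernels are
    truncated: analyticity means a global power series, and a polynomial in [phi] is reached by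
    finitely many sums and Cauchy products; being bounded, it lies in H2. The degree is chosen after
    the point [w], so that the tail vanishes in the limit. How compactness enters: along a
    subsequence the images of the test functions converge in norm to some [g] in H2, and
    [gap z * g z] tends to 0 at the boundary for every fixed [g] in H2. *)

Local Notation Re := (@complex.Re _).
Local Notation Im := (@complex.Im _).

(** * Modulus, real and imaginary parts, and the exponential on the circle *)

Section ComplexNorm.
Variable R : realType.
Implicit Types (x y z : R[i]) (a b : R).

Lemma cnormE z : cnorm z = Num.sqrt (Re z ^+ 2 + Im z ^+ 2).
Proof. by case: z. Qed.

Lemma cnorm_ge0 z : 0 <= cnorm z.
Proof. by rewrite cnormE sqrtr_ge0. Qed.

Lemma sqr_cnorm z : cnorm z ^+ 2 = Re z ^+ 2 + Im z ^+ 2.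
Proof. by rewrite cnormE sqr_sqrtr // addr_ge0 ?sqr_ge0. Qed.

Lemma cnormM x y : cnorm (x * y) = cnorm x * cnorm y.
Proof. exact: Normc.normcM. Qed.

Lemma cnormV z : cnorm z^-1 = (cnorm z)^-1.
Proof. exact: Normc.normcV. Qed.

Lemma cnormD x y : cnorm (x + y) <= cnorm x + cnorm y.
Proof. exact: le_normcD. Qed.

Lemma cnormN z : cnorm (- z) = cnorm z.
Proof. exact: normcN. Qed.

Lemma cnormB x y : cnorm (x - y) <= cnorm x + cnorm y.
Proof. by rewrite -(cnormN y) cnormD. Qed.

Lemma cdistC x y : cnorm (x - y) = cnorm (y - x).
Proof. by rewrite -cnormN opprB. Qed.

Lemma lerB_cnorm x y : cnorm x - cnorm y <= cnorm (x - y).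
Proof. by rewrite lerBlDr -{1}(subrK y x) cnormD. Qed.

Lemma cnorm0 : cnorm (0 : R[i]) = 0.
Proof. exact: Normc.normc0. Qed.

Lemma cnorm1 : cnorm (1 : R[i]) = 1.
Proof. exact: Normc.normc1. Qed.

Lemma cnorm_eq0 z : (cnorm z == 0) = (z == 0).
Proof.
by apply/eqP/eqP => [/Normc.eq0_normc//|->]; exact: cnorm0.
Qed.

Lemma cnorm_gt0 z : (0 < cnorm z) = (z != 0).
Proof. by rewrite lt0r cnorm_eq0 cnorm_ge0 andbT. Qed.

Lemma cnormX z n : cnorm (z ^+ n) = cnorm z ^+ n.
Proof. by elim: n => [|n IH]; rewrite ?expr0 ?cnorm1 // !exprS cnormM IH. Qed.

Lemma cnormR a : cnorm a%:C%C = `|a|.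
Proof. by rewrite cnormE /= expr0n addr0 sqrtr_sqr. Qed.

Lemma cnormJ z : cnorm (z^*)%C = cnorm z.
Proof. by case: z => a b; rewrite !cnormE /= sqrrN. Qed.

Lemma cnorm_sum (I : Type) (s : seq I) (P : pred I) (F : I -> R[i]) :
  cnorm (\sum_(i <- s | P i) F i) <= \sum_(i <- s | P i) cnorm (F i).
Proof.
elim/big_rec2: _ => [|i u v _ le_vu]; first by rewrite cnorm0.
by apply: le_trans (cnormD _ _) _; rewrite lerD2l.
Qed.

Lemma Re_le_cnorm z : `|Re z| <= cnorm z.
Proof. by rewrite cnormE -sqrtr_sqr ler_wsqrtr // lerDl sqr_ge0. Qed.

Lemma Im_le_cnorm z : `|Im z| <= cnorm z.
Proof. by rewrite cnormE -sqrtr_sqr ler_wsqrtr // lerDr sqr_ge0. Qed.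

Lemma cnorm_le_ReIm z : cnorm z <= `|Re z| + `|Im z|.
Proof.
rewrite -[leRHS]ger0_norm ?addr_ge0// -sqrtr_sqr cnormE ler_wsqrtr//.
rewrite sqrrD !real_normK ?num_real// -addrA lerD2l lerDr.
by rewrite mulrn_wge0 // mulr_ge0.
Qed.

Lemma cReD x y : Re (x + y) = Re x + Re y. Proof. by case: x y => ? ? []. Qed.
Lemma cImD x y : Im (x + y) = Im x + Im y. Proof. by case: x y => ? ? []. Qed.
Lemma cReN x : Re (- x) = - Re x. Proof. by case: x. Qed.
Lemma cImN x : Im (- x) = - Im x. Proof. by case: x. Qed.
Lemma cReB x y : Re (x - y) = Re x - Re y. Proof. by rewrite cReD cReN. Qed.
Lemma cImB x y : Im (x - y) = Im x - Im y. Proof. by rewrite cImD cImN. Qed.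
Lemma cReM x y : Re (x * y) = Re x * Re y - Im x * Im y.
Proof. by case: x y => ? ? []. Qed.
Lemma cImM x y : Im (x * y) = Re x * Im y + Im x * Re y.
Proof. by case: x y => ? ? []. Qed.
Lemma cReV x : Re x^-1 = Re x / cnorm x ^+ 2.
Proof. by rewrite sqr_cnorm; case: x. Qed.
Lemma cImV x : Im x^-1 = - Im x / cnorm x ^+ 2.
Proof. by rewrite sqr_cnorm mulNr; case: x. Qed.

Lemma cRe_sum (I : Type) (s : seq I) (P : pred I) (F : I -> R[i]) :
  Re (\sum_(i <- s | P i) F i) = \sum_(i <- s | P i) Re (F i).
Proof. by apply: (big_morph _ cReD). Qed.

Lemma cIm_sum (I : Type) (s : seq I) (P : pred I) (F : I -> R[i]) :
  Im (\sum_(i <- s | P i) F i) = \sum_(i <- s | P i) Im (F i).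
Proof. by apply: (big_morph _ cImD). Qed.

Lemma cconjM x y : ((x * y)^*)%C = (x^*)%C * (y^*)%C.
Proof. exact: rmorphM. Qed.

Lemma cconjX x n : ((x ^+ n)^*)%C = (x^*)%C ^+ n.
Proof. exact: rmorphXn. Qed.

Lemma cconj_sum (I : Type) (s : seq I) (P : pred I) (F : I -> R[i]) :
  ((\sum_(i <- s | P i) F i)^*)%C = \sum_(i <- s | P i) ((F i)^*)%C.
Proof. exact: rmorph_sum. Qed.

Lemma complex_ext x y : Re x = Re y -> Im x = Im y -> x = y.
Proof. by case: x y => ? ? [? ?] /= -> ->. Qed.

Lemma mul_conjc z : z * (z^*)%C = (cnorm z ^+ 2)%:C%C.
Proof.
by rewrite sqr_cnorm; case: z => a b; apply: complex_ext => /=; ring.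
Qed.

Lemma cnorm_expi a : cnorm (expi a) = 1.
Proof. by rewrite cnormE /= cos2Dsin2 sqrtr1. Qed.

Lemma expi0 : expi 0 = 1 :> R[i].
Proof. by rewrite /expi cos0 sin0. Qed.

Lemma expiD a b : expi (a + b) = expi a * expi b.
Proof. by apply: complex_ext; rewrite /= ?cosD ?sinD //; ring. Qed.

Lemma expiMn a n : expi a ^+ n = expi (n%:R * a).
Proof.
elim: n => [|n IH]; first by rewrite mul0r expr0 expi0.
by rewrite exprS IH -expiD -natr1; congr expi; ring.
Qed.

Lemma expi_neq0 a : expi a != 0.
Proof. by rewrite -cnorm_gt0 cnorm_expi. Qed.

Lemma expiN a : expi (- a) = (expi a)^-1.
Proof.
apply: (mulfI (expi_neq0 a)); rewrite -expiD subrr expi0 divff//.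
exact: expi_neq0.
Qed.

Lemma conj_expi a : ((expi a)^*)%C = expi (- a).
Proof. by rewrite /expi cosN sinN. Qed.

End ComplexNorm.

(** * Limits of complex-valued functions along a filter *)

Section ComplexLimits.
Variable R : realType.
Implicit Types l m : R[i].

(* [R[i]] has no canonical topology here, hence this componentwise notion. *)
Definition ccvg T (F : set_system T) (f : T -> R[i]) l :=
  (Re (f x) @[x --> F] --> Re l) /\ (Im (f x) @[x --> F] --> Im l).

Section ccvg.
Variables (T : Type) (F : set_system T).
Context {FF : Filter F}.
Implicit Types f g : T -> R[i].

Lemma ccvg_cst l : ccvg F (fun=> l) l.
Proof. by split; exact: cvg_cst. Qed.

Lemma ccvgD f g l m : ccvg F f l -> ccvg F g m -> ccvg F (fun x => f x + g x) (l + m).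
Proof.
move=> [fl fl'] [gm gm']; split.
  by rewrite cReD; under eq_fun do rewrite cReD; exact: cvgD.
by rewrite cImD; under eq_fun do rewrite cImD; exact: cvgD.
Qed.

Lemma ccvgN f l : ccvg F f l -> ccvg F (fun x => - f x) (- l).
Proof.
move=> [fl fl']; split.
  by rewrite cReN; under eq_fun do rewrite cReN; exact: cvgN.
by rewrite cImN; under eq_fun do rewrite cImN; exact: cvgN.
Qed.

Lemma ccvgB f g l m : ccvg F f l -> ccvg F g m -> ccvg F (fun x => f x - g x) (l - m).
Proof. by move=> fl /ccvgN; exact: ccvgD. Qed.

Lemma ccvgM f g l m : ccvg F f l -> ccvg F g m -> ccvg F (fun x => f x * g x) (l * m).
Proof.
move=> [fl fl'] [gm gm']; split.
  rewrite cReM; under eq_fun do rewrite cReM.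
  by apply: cvgB; exact: cvgM.
rewrite cImM; under eq_fun do rewrite cImM.
by apply: cvgD; exact: cvgM.
Qed.

Lemma ccvg_conj f l : ccvg F f l -> ccvg F (fun x => ((f x)^*)%C) (l^*)%C.
Proof.
have ReJ z : Re ((z^*)%C : R[i]) = Re z by case: z.
have ImJ z : Im ((z^*)%C : R[i]) = - Im z by case: z.
move=> [fl fl']; split; first by rewrite ReJ; under eq_fun do rewrite ReJ.
by rewrite ImJ; under eq_fun do rewrite ImJ; exact: cvgN.
Qed.

Lemma ccvg_cnorm f l : ccvg F f l -> cnorm (f x) @[x --> F] --> cnorm l.
Proof.
move=> [fl fl']; rewrite cnormE; under eq_fun do rewrite cnormE.
apply: continuous_cvg; first exact: sqrt_continuous.
by apply: cvgD; rewrite expr2; under eq_fun do rewrite expr2; exact: cvgM.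
Qed.

Lemma ccvgV f l : l != 0 -> ccvg F f l -> ccvg F (fun x => (f x)^-1) l^-1.
Proof.
move=> l0 fl; have := ccvg_cnorm fl; case: (fl) => fl1 fl2 fn.
have H : (cnorm (f x) ^+ 2)^-1 @[x --> F] --> (cnorm l ^+ 2)^-1.
  apply: cvgV; first by rewrite expf_neq0 // cnorm_eq0.
  by rewrite expr2; under eq_fun do rewrite expr2; exact: cvgM.
split.
  by rewrite cReV; under eq_fun do rewrite cReV; exact: cvgM.
by rewrite cImV; under eq_fun do rewrite cImV; apply: cvgM => //; exact: cvgN.
Qed.

Lemma ccvg_sum (I : Type) (s : seq I) (f : I -> T -> R[i]) (l : I -> R[i]) :
  (forall i, ccvg F (f i) (l i)) ->
  ccvg F (fun x => \sum_(i <- s) f i x) (\sum_(i <- s) l i).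
Proof.
move=> fl; elim: s => [|i s IH].
  by rewrite big_nil; under eq_fun do rewrite big_nil; exact: ccvg_cst.
by rewrite big_cons; under eq_fun do rewrite big_cons; apply: ccvgD => //.
Qed.

Lemma cvg_sqrt (u : T -> R) (a : R) :
  u x @[x --> F] --> a -> Num.sqrt (u x) @[x --> F] --> Num.sqrt a.
Proof. by move=> ua; apply: continuous_cvg => //; exact: sqrt_continuous. Qed.

Lemma cvg_rsum (I : Type) (s : seq I) (u : I -> T -> R) (l : I -> R) :
  (forall i, u i x @[x --> F] --> l i) ->
  \sum_(i <- s) u i x @[x --> F] --> \sum_(i <- s) l i.
Proof.
move=> ul; elim: s => [|i s IH].
  by rewrite big_nil; under eq_fun do rewrite big_nil; exact: cvg_cst.
by rewrite big_cons; under eq_fun do rewrite big_cons; apply: cvgD.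
Qed.

Lemma ccvg_real (u : T -> R) (a : R) :
  u x @[x --> F] --> a -> ccvg F (fun x => (u x)%:C%C) a%:C%C.
Proof. by move=> ua; split => //=; exact: cvg_cst. Qed.

Lemma ccvg_dist0 f l : ccvg F f l <-> cnorm (f x - l) @[x --> F] --> (0 : R).
Proof.
split=> [fl|fl].
  have := ccvg_cnorm (ccvgB fl (ccvg_cst l)).
  by rewrite subrr cnorm0.
split; apply/cvgrPdist_le => e e0; move/cvgrPdist_le: fl => /(_ e e0);
  apply: filterS => x; rewrite sub0r normrN ger0_norm ?cnorm_ge0// => le_e;
  apply: le_trans le_e; rewrite cdistC.
  by rewrite -cReB Re_le_cnorm.
by rewrite -cImB Im_le_cnorm.
Qed.

Lemma ccvg0 f : ccvg F f 0 <-> cnorm (f x) @[x --> F] --> (0 : R).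
Proof. by rewrite ccvg_dist0; under eq_fun do rewrite subr0. Qed.

Lemma ccvg_squeeze f l (u : T -> R) :
  (\forall x \near F, cnorm (f x - l) <= u x) -> u x @[x --> F] --> (0 : R) ->
  ccvg F f l.
Proof.
move=> fu u0; apply/ccvg_dist0.
apply: (@squeeze_cvgr _ _ _ _ (fun=> 0) u) => //; last exact: cvg_cst.
by apply: filterS fu => x ->; rewrite cnorm_ge0.
Qed.

Lemma near_cvgr (u v : T -> R) (a : R) :
  (\forall x \near F, u x = v x) -> u x @[x --> F] --> a -> v x @[x --> F] --> a.
Proof. by move=> uv ua; apply: cvg_trans ua; exact: near_eq_cvg. Qed.

Lemma near_ccvg f g l : (\forall x \near F, f x = g x) -> ccvg F f l -> ccvg F g l.
Proof.
move=> fg [fl fl']; split.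
  by apply: cvg_trans fl; apply: near_eq_cvg; apply: filterS fg => x ->.
by apply: cvg_trans fl'; apply: near_eq_cvg; apply: filterS fg => x ->.
Qed.

End ccvg.

Lemma ccvg_comp T U (F : set_system T) (G : set_system U) (g : U -> T) (f : T -> R[i]) l :
  g @ G --> F -> ccvg F f l -> ccvg G (f \o g) l.
Proof. by move=> gF [fl fl']; split; [apply: cvg_comp gF fl|apply: cvg_comp gF fl']. Qed.

Lemma ccvg_cnorm_le T (F : set_system T) {FF : ProperFilter F} (f : T -> R[i]) l (M : R) :
  ccvg F f l -> (\forall x \near F, cnorm (f x) <= M) -> cnorm l <= M.
Proof. by move=> /ccvg_cnorm fl fM; exact: (cvgr_to_le fl). Qed.

End ComplexLimits.

(** * Integration of bounded complex functions over a set of finite measure *)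

Section ComplexIntegral.
Variables (d : measure_display) (T : measurableType d) (R : realType).
Implicit Types (D : set T) (f g : T -> R[i]).

Definition cmeas D f := measurable_fun D (Re \o f) /\ measurable_fun D (Im \o f).

Definition cbmeas D f := cmeas D f /\ exists M : R, forall t, D t -> cnorm (f t) <= M.

Lemma cmeas_cst D (c : R[i]) : cmeas D (fun=> c).
Proof. by split; exact: measurable_cst. Qed.

Lemma cmeasD D f g : cmeas D f -> cmeas D g -> cmeas D (fun t => f t + g t).
Proof.
move=> [f1 f2] [g1 g2]; split.
  apply: (eq_measurable_fun ((Re \o f) \+ (Re \o g))) => [t _|]; first by rewrite /= cReD.
  exact: measurable_funD.
apply: (eq_measurable_fun ((Im \o f) \+ (Im \o g))) => [t _|]; first by rewrite /= cImD.
exact: measurable_funD.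
Qed.

Lemma cmeasM D f g : cmeas D f -> cmeas D g -> cmeas D (fun t => f t * g t).
Proof.
move=> [f1 f2] [g1 g2]; split.
  apply: (eq_measurable_fun (((Re \o f) \* (Re \o g)) \- ((Im \o f) \* (Im \o g)))) => [t _|].
    by rewrite /= cReM.
  by apply: measurable_funB; exact: measurable_funM.
apply: (eq_measurable_fun (((Re \o f) \* (Im \o g)) \+ ((Im \o f) \* (Re \o g)))) => [t _|].
  by rewrite /= cImM.
by apply: measurable_funD; exact: measurable_funM.
Qed.

Lemma cmeas_conj D f : cmeas D f -> cmeas D (fun t => ((f t)^*)%C).
Proof.
move=> [f1 f2]; split.
  by apply: eq_measurable_fun f1 => t _ /=; case: (f t).
apply: (eq_measurable_fun (\- (Im \o f))) => [t _|]; first by rewrite /=; case: (f t).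
exact: measurableT_comp.
Qed.

Lemma cbmeas_cst D (c : R[i]) : cbmeas D (fun=> c).
Proof. by split; [exact: cmeas_cst|exists (cnorm c)]. Qed.

Lemma cbmeasD D f g : cbmeas D f -> cbmeas D g -> cbmeas D (fun t => f t + g t).
Proof.
move=> [mf [M fM]] [mg [N gN]]; split; first exact: cmeasD.
by exists (M + N) => t Dt; apply: le_trans (cnormD _ _) (lerD (fM _ Dt) (gN _ Dt)).
Qed.

Lemma cbmeasM D f g : cbmeas D f -> cbmeas D g -> cbmeas D (fun t => f t * g t).
Proof.
move=> [mf [M fM]] [mg [N gN]]; split; first exact: cmeasM.
by exists (M * N) => t Dt; rewrite cnormM ler_pM ?cnorm_ge0 ?fM ?gN.
Qed.

Lemma cbmeasN D f : cbmeas D f -> cbmeas D (fun t => - f t).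
Proof.
move=> mf; have -> : (fun t => - f t) = (fun t => -1 * f t).
  by apply/funext => t; rewrite mulN1r.
by apply: cbmeasM => //; exact: cbmeas_cst.
Qed.

Lemma cbmeas_sum (I : Type) (s : seq I) D (F : I -> T -> R[i]) :
  (forall i, cbmeas D (F i)) -> cbmeas D (fun t => \sum_(i <- s) F i t).
Proof.
move=> mF; elim: s => [|i s IH].
  by under eq_fun do rewrite big_nil; exact: cbmeas_cst.
by under eq_fun do rewrite big_cons; exact: cbmeasD.
Qed.

Lemma cbmeasX D f (n : nat) : cbmeas D f -> cbmeas D (fun t => f t ^+ n).
Proof.
move=> mf; elim: n => [|n IH].
  by under eq_fun do rewrite expr0; exact: cbmeas_cst.
by under eq_fun do rewrite exprS; exact: cbmeasM.
Qed.

Lemma cmeas_cvg D (h : nat -> T -> R[i]) f :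
  (forall n, cmeas D (h n)) -> (forall t, D t -> ccvg \oo (h^~ t) (f t)) -> cmeas D f.
Proof.
move=> mh hf; split.
  by apply: (@measurable_fun_cvg _ _ _ _ (fun n => Re \o h n)) => [n|t /hf[]//]; case: (mh n).
by apply: (@measurable_fun_cvg _ _ _ _ (fun n => Im \o h n)) => [n|t /hf[]//]; case: (mh n).
Qed.

Variables (mu : {measure set T -> \bar R}) (D : set T).
Hypotheses (mD : measurable D) (muD : (mu D < +oo)%E).

Lemma bounded_integrable (u : T -> R) (M : R) :
  measurable_fun D u -> (forall t, D t -> `|u t| <= M) -> mu.-integrable D (EFin \o u).
Proof.
move=> mu_ uM; apply: measurable_bounded_integrable => //.
by exists M; split; rewrite ?num_real // => N MN t Dt; apply: le_trans (uM _ Dt) (ltW MN).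
Qed.

Lemma integrable_Re f : cbmeas D f -> mu.-integrable D (EFin \o (Re \o f)).
Proof.
move=> [[mf _] [M fM]]; apply: (bounded_integrable mf) => t Dt.
by apply: le_trans (Re_le_cnorm _) (fM _ Dt).
Qed.

Lemma integrable_Im f : cbmeas D f -> mu.-integrable D (EFin \o (Im \o f)).
Proof.
move=> [[_ mf] [M fM]]; apply: (bounded_integrable mf) => t Dt.
by apply: le_trans (Im_le_cnorm _) (fM _ Dt).
Qed.

Definition cint f : R[i] :=
  (\int[mu]_(t in D) (Re (f t)) +i* \int[mu]_(t in D) (Im (f t)))%C.

Lemma eq_cint f g : (forall t, D t -> f t = g t) -> cint f = cint g.
Proof. by move=> fg; rewrite /cint; congr Complex; apply: eq_Rintegral => t /set_mem /fg ->. Qed.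

Lemma cint_cst c : cint (fun=> c) = c * (fine (mu D))%:C%C.
Proof.
by rewrite /cint !Rintegral_cst //; apply: complex_ext; case: c => a b /=; ring.
Qed.

Lemma cintD f g : cbmeas D f -> cbmeas D g -> cint (fun t => f t + g t) = cint f + cint g.
Proof.
move=> mf mg; apply: complex_ext => /=.
  rewrite -RintegralD //; do ?exact: integrable_Re.
  by apply: eq_Rintegral => t _; rewrite cReD.
rewrite -RintegralD //; do ?exact: integrable_Im.
by apply: eq_Rintegral => t _; rewrite cImD.
Qed.

Lemma cintZ c f : cbmeas D f -> cint (fun t => c * f t) = c * cint f.
Proof.
move=> mf; have iR := integrable_Re mf; have iI := integrable_Im mf.
have iRZ a := integrableZl mD a iR; have iIZ a := integrableZl mD a iI.
apply: complex_ext; rewrite /cint ?cReM ?cImM /=.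
  rewrite -!RintegralZl // -RintegralB //; last 2 first.
  - exact: iRZ.
  - exact: iIZ.
  by apply: eq_Rintegral => t _; rewrite cReM.
rewrite -!RintegralZl // -RintegralD //; last 2 first.
- exact: iIZ.
- exact: iRZ.
by apply: eq_Rintegral => t _; rewrite cImM.
Qed.

Lemma cintN f : cbmeas D f -> cint (fun t => - f t) = - cint f.
Proof.
by move=> mf; rewrite -mulN1r -cintZ //; apply: eq_cint => t _; rewrite mulN1r.
Qed.

Lemma cint_sum (I : Type) (s : seq I) (F : I -> T -> R[i]) :
  (forall i, cbmeas D (F i)) ->
  cint (fun t => \sum_(i <- s) F i t) = \sum_(i <- s) cint (F i).
Proof.
move=> mF; elim: s => [|i s IH].
  rewrite big_nil -[RHS](mul0r (fine (mu D))%:C%C) -cint_cst; apply: eq_cint => t _.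
  by rewrite big_nil.
rewrite big_cons -IH -cintD //; first by apply: eq_cint => t _; rewrite big_cons.
exact: cbmeas_sum.
Qed.

(** The factor 2 is the price of bounding the two components separately. The bound serves for a
    Taylor remainder, where any constant will do. *)
Lemma cnorm_cint_le f (M : R) :
  cmeas D f -> (forall t, D t -> cnorm (f t) <= M) ->
  cnorm (cint f) <= 2 * M * fine (mu D).
Proof.
move=> mf fM; have bmf : cbmeas D f by split => //; exists M.
have bnd (u : T -> R) : mu.-integrable D (EFin \o u) ->
    (forall t, D t -> `|u t| <= M) -> `|\int[mu]_(t in D) u t| <= M * fine (mu D).
  move=> iu uM; rewrite -Rintegral_cst //; apply: le_trans (le_normr_Rintegral mD iu) _.
  apply: le_Rintegral => //; first exact: integrable_norm.
  by apply: (@bounded_integrable _ `|M|) => //; exact: measurable_cst.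
apply: le_trans (cnorm_le_ReIm _) _.
rewrite -mulrA mulr2n mulrDl mul1r lerD //= ; apply: bnd => [|t Dt].
- exact: integrable_Re.
- exact: le_trans (Re_le_cnorm _) (fM _ Dt).
- exact: integrable_Im.
- exact: le_trans (Im_le_cnorm _) (fM _ Dt).
Qed.

Lemma bounded_Rintegral_cvg (u : nat -> T -> R) (v : T -> R) (M : R) :
  (forall n, measurable_fun D (u n)) -> (forall n t, D t -> `|u n t| <= M) ->
  (forall t, D t -> u n t @[n --> \oo] --> v t) ->
  \int[mu]_(t in D) u n t @[n --> \oo] --> \int[mu]_(t in D) v t.
Proof.
move=> mu_ uM uv.
have mv : measurable_fun D v by apply: measurable_fun_cvg uv.
have [iv _ cv] := @dominated_convergence _ _ _ mu D mD (fun n => EFin \o u n) (EFin \o v)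
  (cst M%:E) ltac:(by move=> n; exact/measurable_EFinP) ltac:(exact/measurable_EFinP)
  ltac:(by apply: aeW => t Dt; apply: cvg_EFin; [exact: nearW|exact: uv])
  ltac:(by apply: (@bounded_integrable (cst M) `|M|); [exact: measurable_cst|])
  ltac:(by apply: aeW => t n Dt /=; rewrite lee_fin uM).
apply: fine_cvg; rewrite fineK; first exact: cv.
exact: integrable_fin_num.
Qed.

Lemma cint_cvg (h : nat -> T -> R[i]) f (M : R) :
  (forall n, cmeas D (h n)) -> (forall n t, D t -> cnorm (h n t) <= M) ->
  (forall t, D t -> ccvg \oo (h^~ t) (f t)) ->
  ccvg \oo (fun n => cint (h n)) (cint f).
Proof.
move=> mh hM hf; split => /=.
  apply: (@bounded_Rintegral_cvg (fun n => Re \o h n) (Re \o f) M) => [n|n t Dt|t Dt].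
  - by case: (mh n).
  - exact: le_trans (Re_le_cnorm _) (hM _ _ Dt).
  - by case: (hf t Dt).
apply: (@bounded_Rintegral_cvg (fun n => Im \o h n) (Im \o f) M) => [n|n t Dt|t Dt].
- by case: (mh n).
- exact: le_trans (Im_le_cnorm _) (hM _ _ Dt).
- by case: (hf t Dt).
Qed.

End ComplexIntegral.

(** * Power series on the disc: absolute convergence, products, differentiability *)

Section PowerSeries.
Variable R : realType.
Implicit Types (f g : R[i] -> R[i]) (a b : nat -> R[i]) (z : R[i]) (r : R).

Definition isps f a :=
  forall z, inD z -> ccvg \oo (fun n => \sum_(k < n) a k * z ^+ k) (f z).

Lemma analytic_isps f : analytic_on_D f <-> exists a, isps f a.
Proof.
by split=> -[a fa]; exists a => z /fa H; apply/ccvg_dist0.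
Qed.

Lemma isps_ext f g a : (forall z, inD z -> f z = g z) -> isps f a -> isps g a.
Proof. by move=> fg fa z zD; rewrite -fg //; exact: fa. Qed.

Lemma inD_real r : 0 <= r < 1 -> inD r%:C%C.
Proof. by move=> /andP[r0 r1]; rewrite /inD cnormR ger0_norm. Qed.

Lemma geometric_sum_le r n : 0 <= r < 1 -> \sum_(k < n) r ^+ k <= (1 - r)^-1.
Proof.
move=> /andP[r0 r1]; rewrite -[leRHS]mul1r ler_pdivlMr ?subr_gt0// mulrC.
by rewrite -opprB mulNr -subrX1 opprB lerBlDr lerDl exprn_ge0.
Qed.

(** Each term is a difference of two consecutive partial sums at the point [r], and these converge,
    hence are bounded. *)
Lemma isps_coef_bounded f a r : isps f a -> 0 <= r < 1 ->
  exists A, forall k, cnorm (a k) * r ^+ k <= A.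
Proof.
move=> fa r01; have [M [_ HM]] := cvg_seq_bounded (cvgP _ (ccvg_cnorm (fa _ (inD_real r01)))).
have bM n : cnorm (\sum_(k < n) a k * r%:C%C ^+ k) <= M + 1.
  have := HM (M + 1); rewrite ltrDl ltr01 => /(_ isT n I) /=.
  by rewrite ger0_norm ?cnorm_ge0.
exists ((M + 1) + (M + 1)) => k.
have -> : cnorm (a k) * r ^+ k = cnorm (a k * r%:C%C ^+ k).
  by rewrite cnormM cnormX cnormR ger0_norm //; case/andP: r01.
have -> : a k * r%:C%C ^+ k = \sum_(i < k.+1) a i * r%:C%C ^+ i - \sum_(i < k) a i * r%:C%C ^+ i.
  by rewrite big_ord_recr /= [X in X - _]addrC addrK.
by apply: le_trans (cnormB _ _) _; exact: lerD.
Qed.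

(** The terms are bounded at the midpoint [s] of [r] and 1, so at [r] they are dominated by a
    geometric series of ratio [r / s]. *)
Lemma isps_abs_bounded f a r : isps f a -> 0 <= r < 1 ->
  exists S, forall n, \sum_(k < n) cnorm (a k) * r ^+ k <= S.
Proof.
move=> fa /andP[r0 r1]; pose s := (1 + r) / 2.
have s01 : 0 <= s < 1 by rewrite /s; apply/andP; split; lra.
have s0 : 0 < s by rewrite /s; lra.
have [A fA] := isps_coef_bounded fa s01.
have q01 : 0 <= r / s < 1.
  by rewrite (divr_ge0 r0 (ltW s0)) /= ltr_pdivrMr // mul1r /s; lra.
have A0 : 0 <= A by apply: le_trans (fA 0%N); rewrite mulr_ge0 ?cnorm_ge0 // expr0.
exists (A * (1 - r / s)^-1) => n.
apply: le_trans (ler_wpM2l A0 (geometric_sum_le n q01)); rewrite mulr_sumr.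
apply: ler_sum => k _; rewrite expr_div_n mulrA ler_pdivlMr ?exprn_gt0 //.
by rewrite mulrAC ler_wpM2r ?exprn_ge0.
Qed.

Lemma isps_partial_bounded f a r : isps f a -> 0 <= r < 1 ->
  exists S, forall z n, cnorm z <= r -> cnorm (\sum_(k < n) a k * z ^+ k) <= S.
Proof.
move=> fa r01; have [S fS] := isps_abs_bounded fa r01; exists S => z n zr.
apply: le_trans (cnorm_sum _ _ _) _; apply: le_trans (fS n).
apply: ler_sum => k _; rewrite cnormM cnormX ler_wpM2l ?cnorm_ge0 //.
by rewrite lerXn2r ?nnegrE ?cnorm_ge0 //; case/andP: r01.
Qed.

Lemma ispsD f g a b : isps f a -> isps g b ->
  isps (fun z => f z + g z) (fun k => a k + b k).
Proof.
move=> fa gb z zD; apply: near_ccvg (ccvgD (fa z zD) (gb z zD)).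
apply: nearW => n; rewrite -big_split /=.
by apply: eq_bigr => k _; rewrite mulrDl.
Qed.

Lemma ispsZ f a (c : R[i]) : isps f a -> isps (fun z => c * f z) (fun k => c * a k).
Proof.
move=> fa z zD; apply: near_ccvg (ccvgM (ccvg_cst c) (fa z zD)).
by apply: nearW => n; rewrite mulr_sumr; apply: eq_bigr => k _; rewrite mulrA.
Qed.

Lemma ispsB f g a b : isps f a -> isps g b ->
  isps (fun z => f z - g z) (fun k => a k - b k).
Proof.
move=> fa gb z zD; apply: near_ccvg (ccvgB (fa z zD) (gb z zD)).
apply: nearW => n; rewrite -sumrB.
by apply: eq_bigr => k _; rewrite mulrBl.
Qed.

Lemma isps_poly (c : nat -> R[i]) N :
  isps (fun z => \sum_(k < N) c k * z ^+ k) (fun k => if (k < N)%N then c k else 0).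
Proof.
move=> z zD; apply: near_ccvg (ccvg_cst _); exists N => // n /= Nn.
rewrite (big_ord_widen n (fun k => c k * z ^+ k) Nn) big_mkcond /=.
by apply: eq_bigr => k _; case: ifP; rewrite ?mul0r.
Qed.

Lemma isps_cst (c : R[i]) : isps (fun=> c) (fun k => if (k < 1)%N then c else 0).
Proof.
by apply: isps_ext (isps_poly (fun=> c) 1) => z _; rewrite big_ord1 expr0 mulr1.
Qed.

(** Both sides run over the pairs with [i + j < n]; the left one groups them by [k = i + j], as a
    Cauchy product does. *)
Lemma triangle_sum (V : nmodType) (F : nat -> nat -> V) n :
  \sum_(k < n) \sum_(j < k.+1) F j (k - j)%N =
  \sum_(i < n) \sum_(j < n | (i + j < n)%N) F i j.
Proof.
transitivity (\sum_(k < n) \sum_(j < n | (j <= k)%N) F j (k - j)%N).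
  apply: eq_bigr => k _.
  by rewrite (big_ord_widen n (fun j => F j (k - j)%N)) //.
rewrite (exchange_big_dep predT) //=; apply: eq_bigr => i _.
transitivity (\sum_(i <= k < n) F i (k - i)%N).
  rewrite big_geq_mkord; apply: eq_bigl => k /=; by [].
rewrite -{1}[i : nat]add0n big_addn big_mkord.
rewrite (big_ord_widen n (fun j => F i (j + i - i)%N)) ?leq_subr //.
by apply: eq_big => [j|j _]; rewrite ?addnK // ltn_subRL.
Qed.

(** The product of the partial sums exceeds the Cauchy partial sum by [E n], the terms with
    [i + j >= n]. With [r] the square root of [cnorm z], one half of the decay
    [r ^+ (i + j) * r ^+ (i + j)] gives the factor [r ^+ n], and the other half makes the remaining
    double sum bounded. *)
Lemma isps_mul f g a b : isps f a -> isps g b ->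
  isps (fun z => f z * g z) (fun k => \sum_(j < k.+1) a j * b (k - j)%N).
Proof.
move=> fa gb z zD; pose r := Num.sqrt (cnorm z).
have r01 : 0 <= r < 1.
  by rewrite sqrtr_ge0 /= -sqrtr1 ltr_sqrt ?ltr01.
have [r0 r1] := andP r01.
have zr k : cnorm (z ^+ k) = r ^+ k * r ^+ k.
  by rewrite -exprMn -expr2 sqr_sqrtr ?cnorm_ge0 // cnormX.
have [S fS] := isps_abs_bounded fa r01; have [S' gS] := isps_abs_bounded gb r01.
have S0 : 0 <= S by have := fS 0%N; rewrite big_ord0.
pose E n := \sum_(i < n) \sum_(j < n | (n <= i + j)%N) (a i * z ^+ i) * (b j * z ^+ j).
have En n : cnorm (E n) <= (S * S') * r ^+ n.
  apply: le_trans (cnorm_sum _ _ _) _.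
  apply: (@le_trans _ _ (\sum_(i < n) \sum_(j < n)
      ((cnorm (a i) * r ^+ i) * (cnorm (b j) * r ^+ j)) * r ^+ n)).
    apply: ler_sum => i _; apply: le_trans (cnorm_sum _ _ _) _.
    rewrite big_mkcond /=; apply: ler_sum => j _; case: ifP => [nij|_]; last first.
      by rewrite !mulr_ge0 ?cnorm_ge0 ?exprn_ge0.
    rewrite !cnormM !zr.
    have -> : cnorm (a i) * (r ^+ i * r ^+ i) * (cnorm (b j) * (r ^+ j * r ^+ j)) =
      cnorm (a i) * r ^+ i * (cnorm (b j) * r ^+ j) * r ^+ (i + j) by rewrite exprD; ring.
    apply: ler_wpM2l; first by rewrite !mulr_ge0 ?cnorm_ge0 ?exprn_ge0.
    by apply: ler_wiXn2l => //; exact: ltW.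
  under eq_bigr do rewrite -mulr_suml -mulr_sumr.
  rewrite -!mulr_suml ler_wpM2r ?exprn_ge0 // ler_pM //.
    by apply: sumr_ge0 => i _; rewrite mulr_ge0 ?cnorm_ge0 ?exprn_ge0.
  by apply: sumr_ge0 => i _; rewrite mulr_ge0 ?cnorm_ge0 ?exprn_ge0.
have cE : ccvg \oo E 0.
  apply: (ccvg_squeeze (u := fun n => (S * S') * r ^+ n)).
    by apply: nearW => n; rewrite subr0.
  rewrite -(mulr0 (S * S')); apply: cvgM; first exact: cvg_cst.
  by apply: cvg_expr; rewrite ger0_norm.
rewrite -[X in ccvg _ _ X]subr0.
apply: near_ccvg (ccvgB (ccvgM (fa z zD) (gb z zD)) cE); apply: nearW => n.
under [RHS]eq_bigr do rewrite mulr_suml.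
have -> : \sum_(k < n) \sum_(j < k.+1) a j * b (k - j)%N * z ^+ k =
  \sum_(k < n) \sum_(j < k.+1) (a j * z ^+ j) * (b (k - j)%N * z ^+ (k - j)).
  apply: eq_bigr => k _; apply: eq_bigr => j _.
  rewrite mulrACA -exprD subnKC //; by case: j => j /=; rewrite ltnS.
rewrite (triangle_sum (fun i j => (a i * z ^+ i) * (b j * z ^+ j))) /E.
rewrite mulr_suml -sumrB; apply: eq_bigr => i _; rewrite mulr_sumr.
rewrite (bigID (fun j : 'I_n => (n <= i + j)%N)) /= addrC addrK.
by apply: eq_bigl => j; rewrite -ltnNge.
Qed.

(** Finitely many sums and products suffice for a polynomial in [phi]; composing with an infinite
    series would call for a rearrangement. Only the existence of the coefficients is retained. *)
Lemma analytic_poly_comp phi (c : nat -> R[i]) N : analytic_on_D phi ->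
  exists a, isps (fun z => \sum_(j < N) c j * phi z ^+ j) a.
Proof.
move=> /analytic_isps[a pa].
have pX j : exists b, isps (fun z => phi z ^+ j) b.
  elim: j => [|j [b IH]]; first by eexists; exact: isps_cst.
  by eexists; apply: isps_ext (isps_mul pa IH) => z _; rewrite exprS.
elim: N => [|N [b IH]].
  by eexists; apply: isps_ext (isps_cst 0) => z _; rewrite big_ord0.
have [b' pb'] := pX N.
by eexists; apply: isps_ext (ispsD IH (ispsZ (c N) pb')) => z _; rewrite big_ord_recr.
Qed.

Lemma ccvg_abs_series (c : nat -> R[i]) (S : R) :
  (forall n, \sum_(k < n) cnorm (c k) <= S) ->
  exists l, ccvg \oo (fun n => \sum_(k < n) c k) l.
Proof.
move=> cS.
have H (u : nat -> R) : (forall k, `|u k| <= cnorm (c k)) ->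
    exists l : R, \sum_(k < n) u k @[n --> \oo] --> l.
  move=> uc; have : cvgn [normed series (u : R^o ^nat)].
    apply: nondecreasing_is_cvgn.
      by apply: nondecreasing_series => n _ _; exact: normr_ge0.
    exists S => _ [n _ <-]; rewrite /= /series /= big_mkord.
    by apply: le_trans (cS n); apply: ler_sum.
  move=> /normed_cvg /cvg_ex[l ul]; exists (l : R); apply: cvg_trans ul.
  by apply: near_eq_cvg; apply: nearW => n; rewrite /series /= big_mkord.
have [l1 ul1] := H _ (fun k => Re_le_cnorm (c k)).
have [l2 ul2] := H _ (fun k => Im_le_cnorm (c k)).
by exists (l1 +i* l2)%C; split => /=;
  [under eq_fun do rewrite cRe_sum|under eq_fun do rewrite cIm_sum].
Qed.

(* Complex differentiability tested along real lines through [z]; the limit must not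
   depend on the direction [u]. *)
Definition cdiff f z (L : R[i]) := forall u : R[i], u != 0 ->
  ccvg (0 : R)^' (fun s => (f (z + s%:C%C * u) - f z) / (s%:C%C * u)) L.

Lemma cdiff_taylor f z L (eta C : R) : 0 < eta ->
  (forall h, cnorm h <= eta -> cnorm (f (z + h) - f z - h * L) <= C * cnorm h ^+ 2) ->
  cdiff f z L.
Proof.
move=> eta0 taylor u u0; have un : 0 < cnorm u by rewrite cnorm_gt0.
apply: (ccvg_squeeze (u := fun s : R => `|s| * (C * cnorm u))); last first.
  rewrite -[X in _ --> X](mul0r (C * cnorm u)); apply: cvgM; last exact: cvg_cst.
  by rewrite -[X in _ --> X](@normr0 _ R); apply: cvg_norm; exact: nbhs_dnbhs.
near=> s.
have s0 : s != 0 by near: s; exact: nbhs_dnbhs_neq.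
have su0 : s%:C%C * u != 0 by rewrite mulf_neq0 // -cnorm_eq0 cnormR normr_eq0.
have -> : (f (z + s%:C%C * u) - f z) / (s%:C%C * u) - L =
  (f (z + s%:C%C * u) - f z - s%:C%C * u * L) / (s%:C%C * u).
  by rewrite [RHS]mulrBl [X in _ = _ - X]mulrAC divff // mul1r.
rewrite cnormM cnormV ler_pdivrMr ?cnorm_gt0 //.
apply: le_trans (taylor _ _) _.
  rewrite cnormM cnormR -ler_pdivlMr //.
  by near: s; apply: dnbhs0_le; rewrite divr_gt0.
by rewrite !cnormM !cnormR [leLHS](_ : _ = `|s| * (C * cnorm u) * (`|s| * cnorm u)) //; ring.
Unshelve. all: by end_near.
Qed.

Section PowerRemainder.
Variables (z h : R[i]) (eta : R).
Hypotheses (eta0 : 0 < eta) (heta : cnorm h <= eta).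
Let rho := cnorm z + eta.

Let h_ge0 : 0 <= cnorm h. Proof. exact: cnorm_ge0. Qed.
Let z_ge0 : 0 <= cnorm z. Proof. exact: cnorm_ge0. Qed.
Let rho_ge0 : 0 <= rho. Proof. by rewrite addr_ge0 // ltW. Qed.

(** The number [k * cnorm z ^+ k.-1 * eta] is the linear term in the binomial expansion of
    [rho ^+ k]. The next two bounds have the same source: since [cnorm h <= eta], the terms with at
    least [j] factors [h] are smaller than those of [rho ^+ k] by [(cnorm h / eta) ^+ j], with [j]
    equal to 1, then 2. *)
Lemma cnorm_natpow_le k : cnorm (k%:R * z ^+ k.-1) <= rho ^+ k / eta.
Proof.
rewrite ler_pdivlMr //; elim: k => [|k IH]; first by rewrite mul0r cnorm0 mul0r expr0.
have -> : k.+1%:R * z ^+ k.+1.-1 = z * (k%:R * z ^+ k.-1) + z ^+ k.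
  case: k {IH} => [|k] /=; first by rewrite mul0r mulr0 add0r mul1r.
  by rewrite -[k.+2%:R]natr1 exprS; ring.
apply: (@le_trans _ _ ((cnorm z * cnorm (k%:R * z ^+ k.-1) + cnorm z ^+ k) * eta)).
  by rewrite ler_wpM2r ?(ltW eta0) // -cnormM -cnormX cnormD.
rewrite mulrDl -mulrA exprS {2}/rho mulrDl lerD //.
  by rewrite ler_wpM2l.
by rewrite mulrC ler_wpM2l ?(ltW eta0) // lerXn2r ?nnegrE // lerDl ltW.
Qed.

Lemma cnorm_powB_le k : cnorm ((z + h) ^+ k - z ^+ k) <= cnorm h / eta * rho ^+ k.
Proof.
elim: k => [|k IH]; first by rewrite !expr0 subrr cnorm0 mulr1 divr_ge0 // ltW.
have -> : (z + h) ^+ k.+1 - z ^+ k.+1 = z * ((z + h) ^+ k - z ^+ k) + h * (z + h) ^+ k.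
  by rewrite !exprS; ring.
apply: le_trans (cnormD _ _) _; rewrite !cnormM exprS.
have -> : cnorm h / eta * (rho * rho ^+ k) =
    cnorm z * (cnorm h / eta * rho ^+ k) + cnorm h * rho ^+ k.
  by rewrite {1}/rho; field; rewrite gt_eqF.
apply: lerD; first by rewrite ler_wpM2l.
rewrite ler_wpM2l // cnormX lerXn2r ?nnegrE ?cnorm_ge0 //.
by apply: le_trans (cnormD _ _) _; rewrite lerD2l.
Qed.

Lemma cnorm_pow_taylor_le k :
  cnorm ((z + h) ^+ k - z ^+ k - h * (k%:R * z ^+ k.-1)) <= (cnorm h / eta) ^+ 2 * rho ^+ k.
Proof.
elim: k => [|k IH].
  by rewrite !expr0 subrr mul0r mulr0 subr0 cnorm0 mulr1 sqr_ge0.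
have -> : (z + h) ^+ k.+1 - z ^+ k.+1 - h * (k.+1%:R * z ^+ k.+1.-1) =
   z * ((z + h) ^+ k - z ^+ k - h * (k%:R * z ^+ k.-1)) + h * ((z + h) ^+ k - z ^+ k).
  case: k {IH} => [|k] /=; first by rewrite !expr0 !expr1; ring.
  by rewrite -[k.+2%:R]natr1 !exprS; ring.
apply: le_trans (cnormD _ _) _; rewrite !cnormM [rho ^+ k.+1]exprS.
have -> : (cnorm h / eta) ^+ 2 * (rho * rho ^+ k) =
    cnorm z * ((cnorm h / eta) ^+ 2 * rho ^+ k) + cnorm h * (cnorm h / eta * rho ^+ k).
  by rewrite {1}/rho; field; rewrite gt_eqF.
by apply: lerD; rewrite ler_wpM2l // cnorm_powB_le.
Qed.

End PowerRemainder.

(** Termwise differentiation. As [eta] is half the distance to the circle, the series converges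
    absolutely at radius [cnorm z + eta]; this dominates both the derived series and the sum of the
    second-order remainders. The term [k = 0] carries the factor 0, so the value of [0.-1] is
    harmless. *)
Lemma isps_cdiff f a z : isps f a -> inD z -> exists L, cdiff f z L.
Proof.
move=> fa zD; pose eta := (1 - cnorm z) / 2.
have z1 : cnorm z < 1 by [].
have eta0 : 0 < eta by rewrite /eta; lra.
have r01 : 0 <= cnorm z + eta < 1.
  by rewrite addr_ge0 ?cnorm_ge0 ?(ltW eta0) //= /eta; lra.
have [S fS] := isps_abs_bounded fa r01.
have [|L cL] := @ccvg_abs_series (fun k => a k * (k%:R * z ^+ k.-1)) (S / eta).
  move=> n; rewrite ler_pdivlMr // mulr_suml; apply: le_trans (fS n).
  apply: ler_sum => k _; rewrite cnormM -mulrA ler_wpM2l ?cnorm_ge0 //.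
  by rewrite -ler_pdivlMr // cnorm_natpow_le.
have taylor h : cnorm h <= eta -> cnorm (f (z + h) - f z - h * L) <= (cnorm h / eta) ^+ 2 * S.
  move=> he.
  have zhD : inD (z + h).
    by apply: le_lt_trans (cnormD _ _) _; case/andP: r01 => _; apply: le_lt_trans; rewrite lerD2l.
  apply: (ccvg_cnorm_le (ccvgB (ccvgB (fa _ zhD) (fa _ zD)) (ccvgM (ccvg_cst h) cL))).
  apply: nearW => n.
  rewrite mulr_sumr -!sumrB; apply: le_trans (cnorm_sum _ _ _) _.
  apply: le_trans (ler_wpM2l (sqr_ge0 (cnorm h / eta)) (fS n)); rewrite mulr_sumr.
  apply: ler_sum => k _.
  have -> : a k * (z + h) ^+ k - a k * z ^+ k - h * (a k * (k%:R * z ^+ k.-1)) =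
    a k * ((z + h) ^+ k - z ^+ k - h * (k%:R * z ^+ k.-1)) by ring.
  rewrite cnormM [leRHS]mulrCA ler_wpM2l ?cnorm_ge0 //.
  exact: cnorm_pow_taylor_le.
exists L; apply: (cdiff_taylor eta0 (C := S / eta ^+ 2)) => h he.
apply: le_trans (taylor h he) _; rewrite [leLHS](_ : _ = S / eta ^+ 2 * cnorm h ^+ 2) //.
by field; rewrite gt_eqF.
Qed.

End PowerSeries.

(** * Orthogonality of the characters on the circle and Parseval for trigonometric polynomials *)

Section Fourier.
Variable R : realType.
Implicit Types (f : R[i] -> R[i]) (a : nat -> R[i]) (r t : R).

Local Notation I2pi := (`[0%R, (2 * pi)%R]%classic : set R).
Local Notation leb := (@lebesgue_measure R).

Lemma twopi_gt0 : 0 < 2 * pi :> R.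
Proof. by rewrite mulr_gt0 // pi_gt0. Qed.

Lemma expi2pi : expi (2 * pi) = 1 :> R[i].
Proof. by rewrite /expi mulrC mulr_natr cos2pi sin2pi. Qed.

Lemma lebesgue_I2pi : leb I2pi = (2 * pi)%:E.
Proof. by rewrite lebesgue_measure_itv /= lte_fin twopi_gt0 oppr0 adde0. Qed.

Lemma lebesgue_I2pi_fin : (leb I2pi < +oo)%E.
Proof. by rewrite lebesgue_I2pi ltry. Qed.

Lemma cint_circle_cst (c : R[i]) : cint leb I2pi (fun=> c) = c * (2 * pi)%:C%C.
Proof.
rewrite cint_cst; last exact: measurable_itv.
by congr (_ * _%:C%C); apply: (@congr1 _ _ fine _ (2 * pi)%:E); exact: lebesgue_I2pi.
Qed.

Lemma Rintegral_FTC2 (f F : R -> R) (x y : R) : x < y ->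
  (forall t, is_derive t 1 F (f t)) -> continuous f ->
  \int[leb]_(t in `[x, y]) f t = F y - F x.
Proof.
move=> xy Ff cf; have dF t : derivable F t 1 by case: (Ff t).
have cF : continuous F.
  by move=> t; apply/differentiable_continuous/derivable1_diffP.
rewrite /Rintegral (@continuous_FTC2 _ f F) //.
- exact: continuous_subspaceT.
- split; first by move=> t _; exact: dF.
  + by apply: cvg_at_right_filter; exact: cF.
  + by apply: cvg_at_left_filter; exact: cF.
- by move=> t _; rewrite derive1E; apply: derive_val.
Qed.

Lemma continuous_scaled_cos (w : R) : continuous (fun t => cos (w * t)).
Proof.
by move=> t; apply: continuous_comp; [exact: mulrl_continuous|exact: continuous_cos].
Qed.

Lemma continuous_scaled_sin (w : R) : continuous (fun t => sin (w * t)).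
Proof.
by move=> t; apply: continuous_comp; [exact: mulrl_continuous|exact: continuous_sin].
Qed.

Lemma cmeas_expi (w : R) (D : set R) : cmeas D (fun t => expi (w * t)).
Proof.
split; apply: measurable_funTS; apply: continuous_measurable_fun.
  exact: continuous_scaled_cos.
exact: continuous_scaled_sin.
Qed.

Lemma cbmeas_expi (w : R) (D : set R) : cbmeas D (fun t => expi (w * t)).
Proof. by split; [exact: cmeas_expi|exists 1 => t _; rewrite cnorm_expi]. Qed.

(** The second hypothesis makes the antiderivatives [sin (w t) / w] and [- cos (w t) / w] take equal
    values at both ends. *)
Lemma cint_expi (w : R) : w != 0 -> expi (w * (2 * pi)) = 1 ->
  cint leb I2pi (fun t => expi (w * t)) = 0.
Proof.
move=> w0 /eqP; rewrite eq_complex /= => /andP[/eqP c1 /eqP s0].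
have dw t : is_derive t 1 (fun t => w * t) w.
  have := @is_deriveZ _ _ _ (@idfun R) w _ _ _ (is_derive_id t 1).
  by rewrite [_ *: _]mulr1.
have ds t : is_derive t 1 (fun t => w^-1 * sin (w * t)) (cos (w * t)).
  have h := is_derive1_comp (is_derive_sin (w * t)) (dw t).
  have := @is_deriveZ _ _ _ (sin \o (fun t => w * t)) w^-1 _ _ _ h.
  by move=> h'; apply: is_derive_eq h' _; rewrite /GRing.scale /=; field.
have dc t : is_derive t 1 (fun t => - w^-1 * cos (w * t)) (sin (w * t)).
  have h := is_derive1_comp (is_derive_cos (w * t)) (dw t).
  have := @is_deriveZ _ _ _ (cos \o (fun t => w * t)) (- w^-1) _ _ _ h.
  by move=> h'; apply: is_derive_eq h' _; rewrite /GRing.scale /=; field.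
rewrite /cint /= (Rintegral_FTC2 twopi_gt0 ds (@continuous_scaled_cos w)).
rewrite (Rintegral_FTC2 twopi_gt0 dc (@continuous_scaled_sin w)).
by rewrite s0 c1 !mulr0 sin0 cos0 mulr0 !subrr.
Qed.

Lemma cint_expi_ortho (k l : nat) :
  cint leb I2pi (fun t => expi (k%:R * t) * expi (- l%:R * t)) =
  if k == l then (2 * pi)%:C%C else 0.
Proof.
rewrite (@eq_cint _ _ _ leb I2pi _ (fun t => expi ((k%:R - l%:R) * t))); last first.
  by move=> t _; rewrite -expiD mulrDl.
case: eqVneq => [->|kl].
  rewrite (@eq_cint _ _ _ leb I2pi _ (fun=> 1)); last by move=> t _; rewrite subrr mul0r expi0.
  by rewrite cint_circle_cst mul1r.
apply: cint_expi; first by rewrite subr_eq0 eqr_nat.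
by rewrite mulrDl mulNr expiD expiN -(expiMn (2 * pi) k) -(expiMn (2 * pi) l) expi2pi !expr1n mul1r invr1.
Qed.

Lemma cint_parseval (c : nat -> R[i]) n :
  cint leb I2pi (fun t => (\sum_(k < n) c k * expi (k%:R * t)) *
    ((\sum_(k < n) c k * expi (k%:R * t))^*)%C) =
  (2 * pi * \sum_(k < n) cnorm (c k) ^+ 2)%:C%C.
Proof.
pose F (k l : nat) t := (c k * ((c l)^*)%C) * (expi (k%:R * t) * expi (- l%:R * t)) : R[i].
have bF k l : cbmeas I2pi (F k l).
  by apply: cbmeasM; [exact: cbmeas_cst|apply: cbmeasM; exact: cbmeas_expi].
rewrite (@eq_cint _ _ _ leb I2pi _ (fun t => \sum_(k < n) \sum_(l < n) F k l t)); last first.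
  move=> t _; rewrite mulr_suml; apply: eq_bigr => k _.
  rewrite cconj_sum mulr_sumr; apply: eq_bigr => l _.
  by rewrite /F cconjM conj_expi mulNr; ring.
rewrite cint_sum ?lebesgue_I2pi_fin //; last first.
  by move=> k; apply: cbmeas_sum => l; exact: bF.
rewrite mulr_sumr rmorph_sum /=; apply: eq_bigr => k _.
rewrite cint_sum ?lebesgue_I2pi_fin //; last by move=> l; exact: bF.
rewrite (bigD1 k) //= big1 => [|l lk]; rewrite /F cintZ ?lebesgue_I2pi_fin //; last 3 first.
- by apply: cbmeasM; exact: cbmeas_expi.
- by rewrite cint_expi_ortho eq_sym (negbTE (_ : nat_of_ord l != k)) ?mulr0.
- by apply: cbmeasM; exact: cbmeas_expi.
by rewrite addr0 cint_expi_ortho eqxx mul_conjc -rmorphM mulrC.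
Qed.

End Fourier.

(** * The Hardy norm in terms of Taylor coefficients *)

Section Hardy.
Variable R : realType.
Implicit Types (f g : R[i] -> R[i]) (a b : nat -> R[i]) (r t : R).

Local Notation I2pi := (`[0%R, (2 * pi)%R]%classic : set R).
Local Notation leb := (@lebesgue_measure R).

Definition circle_mean f r : \bar R := (((2 * pi)^-1)%:E *
  \int[leb]_(t in I2pi) ((cnorm (f (r%:C%C * expi t))) ^+ 2)%:E)%E.

Lemma inD_circle r t : 0 <= r < 1 -> inD (r%:C%C * expi t).
Proof.
by case/andP=> r0 r1; rewrite /inD cnormM cnorm_expi mulr1 cnormR ger0_norm.
Qed.

(** On the circle [f] is a pointwise limit of trigonometric polynomials, which are measurable. *)
Lemma cmeas_circle f a r : isps f a -> 0 <= r < 1 ->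
  cmeas I2pi (fun t => f (r%:C%C * expi t)).
Proof.
move=> fa r01; apply: cmeas_cvg (fun t _ => fa _ (inD_circle t r01)) => n.
have bF : cbmeas I2pi (fun t => \sum_(k < n) (a k * r%:C%C ^+ k) * expi (k%:R * t)).
  by apply: cbmeas_sum => k; apply: cbmeasM; [exact: cbmeas_cst|exact: cbmeas_expi].
case: bF => + _; congr (cmeas _ _); apply/funext => t.
by apply: eq_bigr => k _; rewrite exprMn expiMn mulrA.
Qed.

Lemma circle_mean_fin f a r : isps f a -> 0 <= r < 1 ->
  circle_mean f r =
    ((2 * pi)^-1 * \int[leb]_(t in I2pi) (cnorm (f (r%:C%C * expi t)) ^+ 2))%:E /\
  leb.-integrable I2pi (EFin \o (fun t => cnorm (f (r%:C%C * expi t)) ^+ 2)).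
Proof.
move=> fa r01; have mf := cmeas_circle fa r01.
have [S fS] := isps_partial_bounded fa r01.
have bf t : I2pi t -> cnorm (f (r%:C%C * expi t)) <= S.
  move=> _; apply: (ccvg_cnorm_le (fa _ (inD_circle t r01))); apply: nearW => n.
  by apply: fS; rewrite cnormM cnorm_expi mulr1 cnormR ger0_norm //; case/andP: r01.
have if2 : leb.-integrable I2pi (EFin \o (fun t => cnorm (f (r%:C%C * expi t)) ^+ 2)).
  apply: (@bounded_integrable _ _ _ leb I2pi _ (lebesgue_I2pi_fin R) _ (S ^+ 2)) => //.
    have [m1 _] := cmeasM mf (cmeas_conj mf).
    apply: eq_measurable_fun m1 => t _ /=; by rewrite mul_conjc.
  move=> t It; rewrite ger0_norm ?sqr_ge0 // lerXn2r ?nnegrE ?cnorm_ge0 ?bf //.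
  by rewrite (le_trans _ (bf t It)) ?cnorm_ge0.
split => //; rewrite /circle_mean EFinM; congr (_ * _)%E.
by rewrite /Rintegral fineK //; exact: integrable_fin_num.
Qed.

(** Parseval is exact for the Taylor polynomials; these are uniformly bounded on the circle of
    radius [r], so the integral passes to the limit. *)
Lemma parseval_circle f a r : isps f a -> 0 <= r < 1 ->
  exists2 m : R, circle_mean f r = m%:E &
    \sum_(k < n) cnorm (a k) ^+ 2 * r ^+ k.*2 @[n --> \oo] --> m.
Proof.
move=> fa r01; have [fin _] := circle_mean_fin fa r01.
eexists; first exact: fin.
have [S fS] := isps_partial_bounded fa r01.
pose F n t := \sum_(k < n) (a k * r%:C%C ^+ k) * expi (k%:R * t).
have FE n t : F n t = \sum_(k < n) a k * (r%:C%C * expi t) ^+ k.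
  by apply: eq_bigr => k _; rewrite exprMn expiMn mulrA.
have bF n : cbmeas I2pi (F n).
  by apply: cbmeas_sum => k; apply: cbmeasM; [exact: cbmeas_cst|exact: cbmeas_expi].
have FS n t : cnorm (F n t) <= S.
  rewrite FE; apply: fS.
  by rewrite cnormM cnorm_expi mulr1 cnormR ger0_norm //; case/andP: r01.
have /= [c1 _] := @cint_cvg _ _ _ leb I2pi (measurable_itv _) (lebesgue_I2pi_fin R)
  (fun n t => F n t * ((F n t)^*)%C)
  (fun t => f (r%:C%C * expi t) * ((f (r%:C%C * expi t))^*)%C) (S * S)
  (fun n => cmeasM (bF n).1 (cmeas_conj (bF n).1))
  ltac:(by move=> n t _; rewrite cnormM cnormJ ler_pM ?cnorm_ge0)
  ltac:(by move=> t _; have h : ccvg \oo (F^~ t) (f (r%:C%C * expi t));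
    [under eq_fun do rewrite FE; exact: fa (inD_circle t r01)|apply: ccvgM => //; exact: ccvg_conj]).
have -> : \int[leb]_(t in I2pi) (cnorm (f (r%:C%C * expi t)) ^+ 2) =
  \int[leb]_(t in I2pi) Re (f (r%:C%C * expi t) * ((f (r%:C%C * expi t))^*)%C).
  by apply: eq_Rintegral => t _; rewrite mul_conjc.
have p0 : 2 * pi != 0 :> R by rewrite gt_eqF ?twopi_gt0.
apply: cvg_trans (cvgM (cvg_cst (2 * pi)^-1) c1); apply: near_eq_cvg; apply: nearW => n.
have := congr1 Re (cint_parseval (fun k => a k * r%:C%C ^+ k) n).
rewrite /cint /= => ->; rewrite mulKf //; apply: eq_bigr => k _.
rewrite cnormM cnormX cnormR exprMn -exprM muln2 ger0_norm //.
by case/andP: r01.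
Qed.

Lemma H2norm2E f : H2norm2 f = ereal_sup [set circle_mean f r | r in `[(0:R), (1:R)[].
Proof. by []. Qed.

Lemma circle_mean_ge0 f r : (0 <= circle_mean f r)%E.
Proof.
rewrite mule_ge0 ?lee_fin ?invr_ge0 ?(ltW (twopi_gt0 R)) //.
by apply: integral_ge0 => t _; rewrite lee_fin sqr_ge0.
Qed.

Lemma H2norm2_ge0 f : (0 <= H2norm2 f)%E.
Proof.
apply: le_trans (circle_mean_ge0 f 0) _.
by apply: ereal_sup_ubound; exists 0 => //=; rewrite in_itv /= lexx ltr01.
Qed.

Lemma H2norm2_le f a (S : R) : isps f a ->
  (forall n, \sum_(k < n) cnorm (a k) ^+ 2 <= S) -> (H2norm2 f <= S%:E)%E.
Proof.
move=> fa aS; apply: ge_ereal_sup => _ [r /= + <-]; rewrite in_itv /= => r01.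
have [m mE cm] := parseval_circle fa r01; rewrite -/(circle_mean f r) mE lee_fin.
apply: (cvgr_to_le cm); apply: nearW => n; apply: le_trans (aS n).
have [r0 r1] := andP r01.
apply: ler_sum => k _; rewrite ler_piMr ?sqr_ge0 // exprn_ile1 //.
exact: ltW.
Qed.

(** For fixed [n] let [r] tend to 1 from below in the finite weighted sum, which Parseval bounds by
    the circle mean. Together with [H2norm2_le] this identifies [H2norm2 f] with the sum of the
    squared moduli of the coefficients. *)
Lemma H2norm2_ge f a (S : R) : isps f a -> (H2norm2 f <= S%:E)%E ->
  forall n, \sum_(k < n) cnorm (a k) ^+ 2 <= S.
Proof.
move=> fa fS n.
have cn : \sum_(k < n) cnorm (a k) ^+ 2 * r ^+ k.*2 @[r --> (1:R)^'-] -->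
    \sum_(k < n) cnorm (a k) ^+ 2.
  have -> : \sum_(k < n) cnorm (a k) ^+ 2 = \sum_(k < n) cnorm (a k) ^+ 2 * 1 ^+ k.*2.
    by apply: eq_bigr => k _; rewrite expr1n mulr1.
  apply: cvg_at_left_filter; apply: cvg_rsum => k.
  by apply: cvgM; [exact: cvg_cst|exact: exprn_continuous].
apply: (cvgr_to_le cn); near=> r.
have r01 : 0 <= r < 1.
  by apply/andP; split; near: r; [apply: nbhs_left_ge; exact: ltr01|exact: nbhs_left_lt].
have [m mE cm] := parseval_circle fa r01.
have mS : m <= S.
  rewrite -lee_fin -mE; apply: le_trans fS; rewrite H2norm2E.
  by apply: ereal_sup_ubound; exists r => //=; rewrite in_itv.
apply: le_trans mS; apply: (cvgr_to_ge cm); exists n => // p /= np.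
rewrite (big_ord_widen p (fun k => cnorm (a k) ^+ 2 * r ^+ k.*2) np) big_mkcond /=.
apply: ler_sum => k _; case: ifP => // _.
by rewrite mulr_ge0 ?sqr_ge0 // exprn_ge0 //; case/andP: r01.
Unshelve. all: by end_near.
Qed.

Lemma H2norm2_le_sup f a (B : R) : isps f a -> (forall z, inD z -> cnorm (f z) <= B) ->
  (H2norm2 f <= (B ^+ 2)%:E)%E.
Proof.
move=> fa fB; apply: ge_ereal_sup => _ [r /= + <-]; rewrite in_itv /= => r01.
have [mE if2] := circle_mean_fin fa r01.
rewrite -/(circle_mean f r) mE lee_fin ler_pdivrMl ?twopi_gt0 //.
apply: (@le_trans _ _ (\int[leb]_(t in I2pi) (B ^+ 2))).
  apply: le_Rintegral => //.
    apply: (@bounded_integrable _ _ _ leb I2pi _ (lebesgue_I2pi_fin R) _ (B ^+ 2)) => //.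
    by move=> t _; rewrite ger0_norm ?sqr_ge0.
  move=> t _; have fBt := fB _ (inD_circle t r01).
  by rewrite lerXn2r ?nnegrE ?cnorm_ge0 // (le_trans _ fBt) ?cnorm_ge0.
by have /= -> := congr1 Re (cint_circle_cst (B ^+ 2)%:C%C); rewrite mul0r subr0 mulrC.
Qed.

Lemma is_H2_norm2 f : is_H2 f -> H2norm2 f = (H2norm f ^+ 2)%:E.
Proof.
move=> [_ fy]; have f0 := H2norm2_ge0 f.
have fin : H2norm2 f \is a fin_num by rewrite ge0_fin_numE.
by rewrite /H2norm sqr_sqrtr ?fine_ge0 // fineK.
Qed.

Lemma is_H2P f a (S : R) : isps f a ->
  (forall n, \sum_(k < n) cnorm (a k) ^+ 2 <= S) -> is_H2 f /\ H2norm f ^+ 2 <= S.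
Proof.
move=> fa aS; have fS := H2norm2_le fa aS.
have f2 : is_H2 f by split; [apply/analytic_isps; exists a|apply: le_lt_trans fS (ltry _)].
by split => //; rewrite -lee_fin -is_H2_norm2.
Qed.

Lemma is_H2_coef f : is_H2 f -> exists a, isps f a /\
  forall n, \sum_(k < n) cnorm (a k) ^+ 2 <= H2norm f ^+ 2.
Proof.
move=> f2; have [/analytic_isps[a fa] _] := f2; exists a; split => //.
by apply: (H2norm2_ge fa); rewrite is_H2_norm2.
Qed.

Lemma H2norm_ge0 f : 0 <= H2norm f.
Proof. exact: sqrtr_ge0. Qed.

Lemma sqr_cnormD_le (x y : R[i]) :
  cnorm (x + y) ^+ 2 <= 2 * (cnorm x ^+ 2 + cnorm y ^+ 2).
Proof.
apply: (@le_trans _ _ ((cnorm x + cnorm y) ^+ 2)).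
  by rewrite lerXn2r ?nnegrE ?addr_ge0 ?cnorm_ge0 // cnormD.
rewrite -subr_ge0 (_ : _ - _ = (cnorm x - cnorm y) ^+ 2) ?sqr_ge0 //; ring.
Qed.

Lemma is_H2B f g : is_H2 f -> is_H2 g -> is_H2 (fun z => f z - g z).
Proof.
move=> /is_H2_coef[a [fa aS]] /is_H2_coef[b [gb bS]].
have [] // := @is_H2P _ _ (2 * (H2norm f ^+ 2 + H2norm g ^+ 2)) (ispsB fa gb).
move=> n; apply: (@le_trans _ _ (\sum_(k < n) 2 * (cnorm (a k) ^+ 2 + cnorm (b k) ^+ 2))).
  by apply: ler_sum => k _; rewrite -(cnormN (b k)) sqr_cnormD_le.
by rewrite -mulr_sumr big_split ler_wpM2l // lerD.
Qed.

End Hardy.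

(** * Cauchy-Schwarz, Bessel's inequality for kernels, and decay at the boundary *)

Section KernelBounds.
Variable R : realType.
Implicit Types (f g h : R[i] -> R[i]) (a b : nat -> R[i]).

(** The quadratic form [key] is a sum of squares; its value at [(B, C)] is
    [B * (A * B - C ^+ 2)]. *)
Lemma cauchy_schwarz_sum (I : Type) (s : seq I) (x y : I -> R) :
  (\sum_(i <- s) x i * y i) ^+ 2 <= (\sum_(i <- s) x i ^+ 2) * (\sum_(i <- s) y i ^+ 2).
Proof.
set A := \sum_(i <- s) x i ^+ 2; set B := \sum_(i <- s) y i ^+ 2.
set C := \sum_(i <- s) x i * y i.
have B0 : 0 <= B by apply: sumr_ge0 => i _; exact: sqr_ge0.
have A0 : 0 <= A by apply: sumr_ge0 => i _; exact: sqr_ge0.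
have key u v : 0 <= u ^+ 2 * A - 2 * u * v * C + v ^+ 2 * B.
  have -> : u ^+ 2 * A - 2 * u * v * C + v ^+ 2 * B = \sum_(i <- s) (u * x i - v * y i) ^+ 2.
    rewrite !mulr_sumr -sumrB -big_split /=; apply: eq_bigr => i _; ring.
  by apply: sumr_ge0 => i _; exact: sqr_ge0.
have := key B C.
have -> : B ^+ 2 * A - 2 * B * C * C + C ^+ 2 * B = B * (A * B - C ^+ 2) by ring.
have [B0'|B0'] := ltP 0 B; first by rewrite pmulr_rge0 // subr_ge0.
have BE : B = 0 by apply/eqP; rewrite eq_le B0 B0'.
move=> _; rewrite BE mulr0; apply: contraT; rewrite -ltNge => C2.
(* When [B = 0] the form is affine in [v], and this [v] would make it equal to -1. *)
have := key 1 ((A + 1) / (2 * C)); rewrite BE mulr0 addr0.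
have C0 : C != 0 by apply: contraTneq C2 => ->; rewrite expr0n ltxx.
have -> : 1 ^+ 2 * A - 2 * 1 * ((A + 1) / (2 * C)) * C = -1 by field.
by rewrite lerNr oppr0 ler10.
Qed.

Lemma cauchy_schwarz_csum (I : Type) (s : seq I) (x y : I -> R[i]) :
  cnorm (\sum_(i <- s) x i * y i) ^+ 2 <=
  (\sum_(i <- s) cnorm (x i) ^+ 2) * (\sum_(i <- s) cnorm (y i) ^+ 2).
Proof.
apply: le_trans (cauchy_schwarz_sum _ _ _).
rewrite lerXn2r ?nnegrE ?cnorm_ge0 ?sumr_ge0 // => [i _|].
  by rewrite mulr_ge0 ?cnorm_ge0.
apply: le_trans (cnorm_sum _ _ _) _; apply: ler_sum => i _.
by rewrite cnormM.
Qed.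

(** The bound is uniform in [n], so it applies to the Gram matrix of truncated kernels; the 2 bounds
    the modulus of [1 - x ^+ n]. *)
Lemma cnorm_geometric_le (x : R[i]) n : cnorm x < 1 ->
  cnorm (\sum_(k < n) x ^+ k) <= 2 / cnorm (1 - x).
Proof.
move=> x1; have x0 : 0 < cnorm (1 - x).
  rewrite cnorm_gt0 subr_eq0; apply: contraTneq x1 => <-.
  by rewrite cnorm1 ltxx.
rewrite ler_pdivlMr // -cnormM mulrC -opprB mulNr -subrX1 opprB.
apply: le_trans (cnormB _ _) _; rewrite cnorm1 cnormX -[2]/(1 + 1) lerD2l.
by rewrite exprn_ile1 ?cnorm_ge0 // ltW.
Qed.

(** For [z] in the disc, the reciprocal of the H2 norm of the reproducing kernel at [z]. *)
Definition gap (z : R[i]) : R := Num.sqrt (1 - cnorm z ^+ 2).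

Lemma gap_ge0 z : 0 <= gap z. Proof. exact: sqrtr_ge0. Qed.

Lemma cnorm_sqr_lt1 (z : R[i]) : inD z -> cnorm z ^+ 2 < 1.
Proof. by move=> zD; rewrite exprn_ilt1 ?cnorm_ge0. Qed.

Lemma sqr_gap z : inD z -> gap z ^+ 2 = 1 - cnorm z ^+ 2.
Proof. by move=> zD; rewrite sqr_sqrtr // subr_ge0 ltW // cnorm_sqr_lt1. Qed.

(* Bessel's inequality for the normalized kernels [gap z_i / (1 - conj z_i w)],
   whose Gram matrix is within [delta] of the identity. *)
Lemma bessel_kernels h m (z : 'I_m -> R[i]) (delta : R) : is_H2 h ->
  (forall i, inD (z i)) ->
  (forall i j, i != j ->
     gap (z i) * gap (z j) * 2 / cnorm (1 - z i * ((z j)^*)%C) <= delta) ->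
  0 <= delta ->
  \sum_(i < m) (gap (z i) * cnorm (h (z i))) ^+ 2 <= H2norm h ^+ 2 * (1 + m%:R * delta).
Proof.
move=> h2 zD zdelta delta0; have [a [ha aS]] := is_H2_coef h2.
set N2 := H2norm h ^+ 2 in aS *.
pose g i := gap (z i); pose beta i := (g i)%:C%C * h (z i).
have nbeta i : cnorm (beta i) = g i * cnorm (h (z i)).
  by rewrite cnormM cnormR ger0_norm ?gap_ge0.
pose B := \sum_(i < m) cnorm (beta i) ^+ 2.
have -> : \sum_(i < m) (gap (z i) * cnorm (h (z i))) ^+ 2 = B.
  by apply: eq_bigr => i _; rewrite nbeta.
have B0 : 0 <= B by apply: sumr_ge0 => i _; exact: sqr_ge0.
pose b i := ((beta i)^*)%C * (g i)%:C%C.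
have nb i : cnorm (b i) = cnorm (beta i) * g i.
  by rewrite cnormM cnormJ cnormR ger0_norm ?gap_ge0.
have bE i : b i * h (z i) = (cnorm (beta i) ^+ 2)%:C%C.
  by rewrite -mul_conjc /b -mulrA mulrC.
clearbody b; clearbody beta.
(* The conjugates of the [y k] are the Taylor coefficients of the combination of normalized kernels
   with coefficients [beta i]; the inner product of [h] with it is [B]. *)
pose y k := \sum_(i < m) b i * z i ^+ k.
have sum_y n : \sum_(k < n) cnorm (y k) ^+ 2 <= B * (1 + m%:R * delta).
  have -> : \sum_(k < n) cnorm (y k) ^+ 2 =
    Re (\sum_(i < m) \sum_(j < m) b i * ((b j)^*)%C * \sum_(k < n) (z i * ((z j)^*)%C) ^+ k).
    rewrite [X in Re X](_ : _ = \sum_(k < n) y k * ((y k)^*)%C).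
      by rewrite cRe_sum; apply: eq_bigr => k _; rewrite mul_conjc.
    under eq_bigr do (under eq_bigr do rewrite mulr_sumr; rewrite exchange_big /=).
    rewrite exchange_big /=; apply: eq_bigr => k _.
    rewrite /y mulr_suml; apply: eq_bigr => i _.
    rewrite cconj_sum mulr_sumr; apply: eq_bigr => j _.
    by rewrite cconjM cconjX exprMn; ring.
  apply: le_trans (ler_norm _) _; apply: le_trans (Re_le_cnorm _) _.
  apply: (@le_trans _ _ (\sum_(i < m) (cnorm (beta i) ^+ 2 +
      \sum_(j < m) cnorm (beta i) * cnorm (beta j) * delta))).
    apply: le_trans (cnorm_sum _ _ _) _; apply: ler_sum => i _.
    apply: le_trans (cnorm_sum _ _ _) _.
    rewrite (bigD1 i) //= lerD //.
      rewrite !cnormM cnormJ !nb.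
      have zi1 := cnorm_sqr_lt1 (zD i).
      apply: (@le_trans _ _ (cnorm (beta i) * g i * (cnorm (beta i) * g i) * (1 - cnorm (z i) ^+ 2)^-1)).
        rewrite ler_wpM2l ?mulr_ge0 ?cnorm_ge0 ?gap_ge0 //.
        apply: le_trans (geometric_sum_le n (_ : 0 <= cnorm (z i) ^+ 2 < 1)); last by rewrite sqr_ge0.
        apply: le_trans (cnorm_sum _ _ _) _; apply: ler_sum => k _.
        by rewrite cnormX cnormM cnormJ -expr2.
      rewrite -sqr_gap // [leLHS](_ : _ = cnorm (beta i) ^+ 2) // /g; field.
      by rewrite gt_eqF // sqrtr_gt0 subr_gt0.
    rewrite [leRHS](bigD1 i) //= ler_wpDl ?mulr_ge0 ?cnorm_ge0 //.
    apply: ler_sum => j ji; rewrite !cnormM cnormJ !nb.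
    have zz1 : cnorm (z i * ((z j)^*)%C) < 1.
      by rewrite cnormM cnormJ mulr_ilt1 ?cnorm_ge0 //; exact: zD.
    apply: (@le_trans _ _ (cnorm (beta i) * g i * (cnorm (beta j) * g j) *
       (2 / cnorm (1 - z i * ((z j)^*)%C)))).
      rewrite ler_wpM2l ?mulr_ge0 ?cnorm_ge0 ?gap_ge0 //.
      exact: cnorm_geometric_le.
    have -> : cnorm (beta i) * g i * (cnorm (beta j) * g j) * (2 / cnorm (1 - z i * ((z j)^*)%C)) =
      cnorm (beta i) * cnorm (beta j) * (g i * g j * 2 / cnorm (1 - z i * ((z j)^*)%C)) by ring.
    by rewrite ler_wpM2l ?mulr_ge0 ?cnorm_ge0 // zdelta // eq_sym.
  rewrite big_split /= -/B mulrDr mulr1 lerD2l.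
  (* Cauchy-Schwarz against the constant 1 bounds the off-diagonal part by [m * B * delta]. *)
  have -> : \sum_(i < m) \sum_(j < m) cnorm (beta i) * cnorm (beta j) * delta =
     (\sum_(i < m) 1 * cnorm (beta i)) ^+ 2 * delta.
    under [in RHS]eq_bigr do rewrite mul1r.
    rewrite expr2 -mulrA mulr_suml; apply: eq_bigr => i _.
    by rewrite mulr_suml mulr_sumr; apply: eq_bigr => j _; rewrite mulrA.
  rewrite mulrA [B * _]mulrC ler_wpM2r //; apply: le_trans (cauchy_schwarz_sum _ _ _) _.
  rewrite ler_wpM2r //.
  by under eq_bigr do rewrite expr1n; rewrite sumr_const card_ord.
have cB : ccvg \oo (fun n => \sum_(k < n) a k * y k) B%:C%C.
  have -> : B%:C%C = \sum_(i < m) b i * h (z i).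
    rewrite rmorph_sum /=; apply: eq_bigr => i _.
    by rewrite bE.
  apply: near_ccvg (ccvg_sum _ (fun i => ccvgM (ccvg_cst (b i)) (ha _ (zD i)))).
  apply: nearW => n; under eq_bigr do rewrite mulr_sumr.
  rewrite exchange_big /=; apply: eq_bigr => k _; rewrite mulr_sumr.
  by apply: eq_bigr => i _; rewrite mulrCA.
(* Cauchy-Schwarz between the coefficients of [h] and the [y k], in the limit of long partial sums;
   dividing by [B] gives the claim. *)
have B2 : B ^+ 2 <= N2 * (B * (1 + m%:R * delta)).
  have cB' : cnorm (\sum_(k < n) a k * y k) @[n --> \oo] --> B.
    by rewrite -[B]ger0_norm // -cnormR; exact: ccvg_cnorm.
  rewrite [B ^+ 2]expr2; apply: (cvgr_to_le (cvgM cB' cB')); apply: nearW => n /=.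
  rewrite -expr2; apply: le_trans (cauchy_schwarz_csum _ _ _) _.
  by apply: ler_pM; [apply: sumr_ge0 => k _; exact: sqr_ge0..|exact: aS|exact: sum_y].
have [B0'|B0'] := ltP 0 B.
  by rewrite -(ler_pM2l B0') -expr2; apply: le_trans B2 _; rewrite mulrCA.
apply: le_trans B0' _; rewrite mulr_ge0 ?sqr_ge0 // addr_ge0 // mulr_ge0 //.
Qed.

(** The case of a single kernel, whose Gram matrix has no off-diagonal entry. *)
Lemma H2_pointwise h z : is_H2 h -> inD z -> gap z * cnorm (h z) <= H2norm h.
Proof.
move=> h2 zD.
have := @bessel_kernels h 1 (fun=> z) 0 h2 (fun=> zD) _ (lexx 0).
rewrite big_ord1 mulr0 addr0 mulr1 => H.
rewrite -(@ler_pXn2r _ 2) ?nnegrE ?mulr_ge0 ?gap_ge0 ?cnorm_ge0 ?H2norm_ge0 //.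
by apply: H => i j; rewrite !ord1 eqxx.
Qed.

(** Normalized kernels tend weakly to 0 at the boundary. A Taylor polynomial [q] of [h] is bounded
    on the disc, so [gap] kills it; the remainder [h - q] has norm at most [e / 2], and
    [H2_pointwise] controls it at every point. *)
Lemma H2_boundary_decay h (z : nat -> R[i]) : is_H2 h -> (forall n, inD (z n)) ->
  gap (z n) @[n --> \oo] --> (0 : R) ->
  gap (z n) * cnorm (h (z n)) @[n --> \oo] --> (0 : R).
Proof.
move=> h2 zD z0; have [a [ha aS]] := is_H2_coef h2.
pose u n := \sum_(k < n) cnorm (a k) ^+ 2.
have u_nd : nondecreasing_seq u.
  apply/nondecreasing_seqP => n; rewrite /u big_ord_recr /= lerDl sqr_ge0 //.
have u_cvg : cvgn u.
  by apply: nondecreasing_is_cvgn => //; exists (H2norm h ^+ 2) => _ [n _ <-]; exact: aS.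
apply/cvgrPdist_le => e e0.
have e2 : 0 < (e / 2) ^+ 2 by rewrite exprn_gt0 // divr_gt0.
have [N _ /(_ N (leqnn N)) /= uN] := (cvgrPdist_le _ _).1 u_cvg _ e2.
pose c k := a k - (if (k < N)%N then a k else 0).
pose q w := \sum_(k < N) a k * w ^+ k.
have hc : isps (fun w => h w - q w) c by apply: ispsB => //; exact: isps_poly.
have [|hq2 hqS] := @is_H2P _ _ _ ((e / 2) ^+ 2) hc.
  move=> n; apply: (@le_trans _ _ (u (maxn n N) - u N)); last first.
    apply: le_trans uN; apply: le_trans (ler_norm _).
    by rewrite lerD2r; exact: nondecreasing_cvgn_le.
  rewrite lerBrDr /u (big_ord_widen _ (fun k => cnorm (c k) ^+ 2) (leq_maxl n N)).
  rewrite (big_ord_widen _ (fun k => cnorm (a k) ^+ 2) (leq_maxr n N)).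
  rewrite big_mkcond [X in _ + X]big_mkcond -big_split /=; apply: ler_sum => k _.
  rewrite /c; case: ltnP => _; case: ltnP => _;
    by rewrite ?subrr ?subr0 ?cnorm0 ?expr0n ?add0r ?addr0 ?sqr_ge0.
pose M := \sum_(k < N) cnorm (a k).
have M0 : 0 <= M by apply: sumr_ge0 => k _; exact: cnorm_ge0.
have qM w : inD w -> cnorm (q w) <= M.
  move=> wD; apply: le_trans (cnorm_sum _ _ _) _; apply: ler_sum => k _.
  by rewrite cnormM cnormX ler_piMr ?cnorm_ge0 // exprn_ile1 ?cnorm_ge0 // ltW.
have zM : gap (z n) * M @[n --> \oo] --> (0 : R).
  by rewrite -[X in _ --> X](mul0r M); apply: cvgM => //; exact: cvg_cst.
have e20 : 0 < e / 2 by rewrite divr_gt0.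
move/cvgrPdist_le: zM => /(_ _ e20); apply: filterS => n.
rewrite !sub0r !normrN !ger0_norm ?mulr_ge0 ?gap_ge0 ?cnorm_ge0 // => zn.
rewrite -[h (z n)](subrK (q (z n))).
apply: le_trans (ler_wpM2l (gap_ge0 _) (cnormD _ _)) _.
rewrite mulrDr [leRHS](_ : _ = e / 2 + e / 2); last by field.
apply: lerD; last by apply: le_trans zn; rewrite ler_wpM2l ?gap_ge0 ?qM.
apply: le_trans (H2_pointwise hq2 (zD n)) _.
by rewrite -(@ler_pXn2r _ 2) ?nnegrE ?H2norm_ge0 // ltW.
Qed.

End KernelBounds.

(** * Differentiable functions on the disc with constant real part *)

Section RealPartRigidity.
Variable R : realType.
Implicit Types (f g : R[i] -> R[i]) (z u L : R[i]).

Lemma inD0 : inD (0 : R[i]).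
Proof. by rewrite /inD cnorm0 ltr01. Qed.

Lemma ccvg_line z u : ccvg (0 : R)^' (fun s => z + s%:C%C * u) z.
Proof.
rewrite -[X in ccvg _ _ X]addr0; apply: ccvgD; first exact: ccvg_cst.
rewrite -[X in ccvg _ _ X](mul0r u); apply: ccvgM; last exact: ccvg_cst.
by apply: ccvg_real; exact: nbhs_dnbhs.
Qed.

Lemma near_inD z u : inD z -> \forall s \near (0 : R)^', inD (z + s%:C%C * u).
Proof. by move=> zD; exact: (cvgr_lt _ (ccvg_cnorm (ccvg_line z u))). Qed.

Lemma cdiffB f g z L L' : cdiff f z L -> cdiff g z L' ->
  cdiff (fun w => f w - g w) z (L - L').
Proof.
move=> fL gL u u0; apply: near_ccvg (ccvgB (fL u u0) (gL u u0)).
by apply: nearW => s; rewrite -mulrBl; congr (_ / _); ring.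
Qed.

Lemma cdiff_cont f z L u : cdiff f z L -> ccvg (0 : R)^' (fun s => f (z + s%:C%C * u)) (f z).
Proof.
move=> fL; have [->|u0] := eqVneq u 0.
  by apply: near_ccvg (ccvg_cst (f z)); apply: nearW => s; rewrite mulr0 addr0.
have h0 : ccvg (0 : R)^' (fun s => s%:C%C * u) 0.
  rewrite -[X in ccvg _ _ X](mul0r u); apply: ccvgM; last exact: ccvg_cst.
  by apply: ccvg_real; exact: nbhs_dnbhs.
have -> : f z = L * 0 + f z by rewrite mulr0 add0r.
apply: near_ccvg (ccvgD (ccvgM (fL u u0) h0) (ccvg_cst (f z))); near=> s.
have s0 : s != 0 by near: s; exact: nbhs_dnbhs_neq.
have su0 : s%:C%C * u != 0 by rewrite mulf_neq0 // -cnorm_eq0 cnormR normr_eq0.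
by rewrite divfK // subrK.
Unshelve. all: by end_near.
Qed.

Lemma cdiff_inv1B f z L (c : R[i]) : cdiff f z L -> inD z ->
  (forall w, inD w -> 1 - c * f w != 0) ->
  cdiff (fun w => (1 - c * f w)^-1) z (c * L / (1 - c * f z) / (1 - c * f z)).
Proof.
move=> fL zD nz u u0.
have cinv : ccvg (0 : R)^' (fun s => (1 - c * f (z + s%:C%C * u))^-1) (1 - c * f z)^-1.
  apply: ccvgV; first exact: nz.
  by apply: ccvgB (ccvg_cst 1) (ccvgM (ccvg_cst c) (cdiff_cont u fL)).
apply: near_ccvg (ccvgM (ccvgM (ccvgM (ccvg_cst c) (fL u u0)) cinv) (ccvg_cst _)).
near=> s.
have s0 : s != 0 by near: s; exact: nbhs_dnbhs_neq.
have su0 : s%:C%C * u != 0 by rewrite mulf_neq0 // -cnorm_eq0 cnormR normr_eq0.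
have n1 := nz _ zD.
have n2 : 1 - c * f (z + s%:C%C * u) != 0 by apply: nz; near: s; exact: near_inD.
move: su0 n1 n2; set w := f (z + _); set h := s%:C%C * u; set v := f z => su0 n1 n2.
by field; rewrite n2 n1 su0.
Unshelve. all: by end_near.
Qed.

Lemma cancel_line (x z : R[i]) (s : R) : s != 0 -> z != 0 ->
  x / (s%:C%C * z) * z = x * (s^-1)%:C%C.
Proof. by move=> s0 z0; rewrite invfM mulrA divfK // fmorphV. Qed.

Lemma cIm_mulr (x : R[i]) (s : R) : Im (x * s%:C%C) = Im x * s.
Proof. by rewrite cImM /= mulr0 add0r. Qed.

(* Cauchy--Riemann: a constant real part forces a zero derivative, hence the function is
   constant along the segments from the origin. *)
Lemma cdiff_const f (kappa : R) : (forall z, inD z -> exists L, cdiff f z L) ->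
  (forall z, inD z -> Re (f z) = kappa) -> forall z, inD z -> f z = f 0.
Proof.
move=> df Ref.
have d0 z : inD z -> cdiff f z 0.
  move=> zD; have [L fL] := df z zD; suff -> : 0 = L by [].
  have oneN0 : (1 : R[i]) != 0 by exact: oner_neq0.
  have iN0 : ('i%C : R[i]) != 0.
    by apply/eqP => -[] /eqP; rewrite oner_eq0.
  (* All increments of [f] are purely imaginary: the quotient in direction 1 has real part 0, the
     one in direction ['i] has imaginary part 0, and both tend to [L]. *)
  have [r1 _] := fL 1 oneN0; have [_ i1] := fL 'i%C iN0.
  apply: complex_ext => /=; apply/esym.
    apply: (cvg_unique _ r1 _) => //; apply: near_cvgr (cvg_cst 0); near=> s.
    have Hs : inD (z + s%:C%C * 1) by near: s; exact: near_inD.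
    rewrite mulr1 in Hs *.
    by rewrite cReM cReB !Ref // subrr mul0r sub0r cImV /= oppr0 mul0r mulr0 oppr0.
  apply: (cvg_unique _ i1 _) => //; apply: near_cvgr (cvg_cst 0); near=> s.
  have Hs : inD (z + s%:C%C * 'i%C) by near: s; exact: near_inD.
  by rewrite cImM cReB !Ref // subrr mul0r add0r cReV cReM /= !(mul0r, mulr0) subr0 mul0r mulr0.
move=> z zD.
apply: complex_ext; first by rewrite !Ref //; exact: inD0.
pose g (t : R) := Im (f (t%:C%C * z)).
have [->//|z0] := eqVneq z 0.
have tzD t : t \in `[(0:R), 1] -> inD (t%:C%C * z).
  rewrite in_itv /= => /andP[t0 t1]; rewrite /inD cnormM cnormR ger0_norm //.
  by apply: le_lt_trans zD; rewrite ler_piMl ?cnorm_ge0.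
have dg t : t \in `[(0:R), 1] -> is_derive t 1 g 0.
  move=> t01; have := d0 _ (tzD t t01) _ z0 => h.
  (* Multiplying by [z] turns the complex quotient in direction [z] into the real quotient in [s],
     whose imaginary part is that of [g]. *)
  have [_] : ccvg (0 : R)^' (fun s => (f (t%:C%C * z + s%:C%C * z) - f (t%:C%C * z)) /
      (s%:C%C * z) * z) 0.
    by rewrite -[X in ccvg _ _ X](mul0r z); exact: ccvgM h (ccvg_cst z).
  move=> h'.
  have {}h' : s^-1 *: ((g \o shift t) (s *: 1) - g t) @[s --> (0:R)^'] --> (0:R).
    apply: near_cvgr h'; near=> s.
    have s0 : s != 0 by near: s; exact: nbhs_dnbhs_neq.
    rewrite cancel_line // cIm_mulr -cImB /g [RHS]mulrC.
    by rewrite [shift t _](_ : _ = s + t) /= ?[s *: 1]mulr1 // rmorphD /= mulrDl [_ + t%:C%C * z]addrC.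
  by apply: DeriveDef; [apply/cvg_ex; exists 0|exact: cvg_lim h'].
have le01 : (0 : R) <= 1 := ler01.
have gc : {within `[(0:R), 1], continuous g}.
  by apply: derivable_within_continuous => x /dg [].
have g' (x : R) : x \in `]0, 1[ -> is_derive x 1 g 0 by move=> /subset_itv_oo_cc /dg.
have [c _] := MVT_segment le01 g' gc.
rewrite mul0r => /eqP; rewrite subr_eq0 => /eqP g10.
have e1 : (1 : R)%:C%C * z = z by exact: mul1r.
have e0 : (0 : R)%:C%C * z = 0 by exact: mul0r.
by move: g10; rewrite /g e1 e0.
Unshelve. all: by end_near.
Qed.

End RealPartRigidity.

(** * The Clark measure, its Cauchy transform, and its atoms as nontangential limits *)

Section ClarkMeasure.
Variable R : realType.
Implicit Types (z w : R[i]) (t s : R).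

(** Both sides are the real part of [(1 + w) / (1 - w)]. With [w = expi (- t) * z] the left side is
    the Poisson kernel; with [w = conj alpha * phi z] it is the right side of the Clark identity. *)
Lemma half_plane_identity w : w != 1 ->
  (1 - cnorm w ^+ 2) / cnorm (1 - w) ^+ 2 = 2 * Re (1 - w)^-1 - 1.
Proof.
move=> w1; have n0 : cnorm (1 - w) ^+ 2 != 0.
  by rewrite expf_neq0 // cnorm_eq0 subr_eq0 eq_sym.
apply: (mulIf n0); rewrite divfK // mulrBl cReV.
rewrite [2 * (_ / _)]mulrA divfK // mul1r !sqr_cnorm cReB cImB /=; ring.
Qed.

Lemma inD_neq1 w : inD w -> w != 1.
Proof. by apply: contraTneq => ->; rewrite /inD cnorm1 ltxx. Qed.

Lemma inD_rot w c : cnorm c = 1 -> inD w -> inD (c * w).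
Proof. by move=> c1; rewrite /inD cnormM c1 mul1r. Qed.

Lemma subr1_neq0 w : inD w -> 1 - w != 0.
Proof. by move=> /inD_neq1; rewrite subr_eq0 eq_sym. Qed.

Lemma ccvg_geometric w : inD w -> ccvg \oo (fun n => \sum_(k < n) w ^+ k) (1 - w)^-1.
Proof.
move=> wD; have w1 := subr1_neq0 wD.
have -> : (1 - w)^-1 = (1 - 0) / (1 - w) by rewrite subr0 mul1r.
apply: near_ccvg (ccvgM (ccvgB (g := fun n => w ^+ n) (ccvg_cst 1) _) (ccvg_cst _)).
  apply: nearW => n; apply: (mulIf w1); rewrite divfK // mulrC.
  by rewrite -[LHS]opprB subrX1 -mulNr opprB.
apply/ccvg0; under eq_fun do rewrite cnormX.
by apply: cvg_expr; rewrite ger0_norm ?cnorm_ge0.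
Qed.

(** With [x] half of [t - s], the cosine of [2 x] equals 1 only if [sin x = 0], which is impossible
    for [x] strictly between 0 and [pi]. *)
Lemma expi_inj s t : 0 <= s < 2 * pi -> 0 <= t < 2 * pi -> expi s = expi t -> s = t.
Proof.
wlog st : s t / s <= t => [H s0 t0 e|/andP[s0 s2] /andP[t0 t2] e].
  by have [|/ltW] := leP s t => st; [exact: H|apply/esym; exact: H].
have e1 : expi (t - s) = 1 by rewrite expiD expiN -e divff // expi_neq0.
pose x := (t - s) / 2; have xE : t - s = x *+ 2 by rewrite /x -mulr_natr; field.
have := congr1 Re e1; rewrite /= xE cosD => c1.
have sx : sin x = 0.
  have := cos2Dsin2 x => c2; apply/eqP; rewrite -sqrf_eq0; apply/eqP; lra.
have [x0|x0] := leP x 0; first by apply/eqP; rewrite eq_le st /=; rewrite /x in x0; lra.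
have : 0 < sin x by apply: sin_gt0_pi; rewrite x0 /= /x; lra.
by rewrite sx ltxx.
Qed.

Variables (phi : R[i] -> R[i]) (alpha : R[i]) (mu : {measure set R -> \bar R}).
Hypotheses (phi_self : analytic_selfmap phi) (alpha1 : cnorm alpha = 1)
  (clark : is_clark_measure phi alpha mu).

Local Notation T0 := (`[0%R, (2 * pi)%R[%classic : set R).

Let mT0 : measurable T0. Proof. exact: measurable_itv. Qed.

(** At [z = 0] the Poisson kernel is identically 1, so the Clark identity there gives the total mass
    as a real number. *)
Lemma clark_fin : (mu T0 < +oo)%E.
Proof.
have [_ /(_ 0 (inD0 R))] := clark.
have -> : (\int[mu]_(t in T0) (poisson 0 t)%:E)%E = mu T0.
  rewrite -[RHS]mul1e -integral_cst //; apply: eq_integral => t _.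
  by rewrite /poisson cnorm0 subr0 cnorm_expi expr0n subr0 expr1n divr1.
by move=> ->; rewrite ltry.
Qed.

Let q z t : R[i] := (1 - expi (- t) * z)^-1.

Let wD z t : inD z -> inD (expi (- t) * z).
Proof. by apply: inD_rot; rewrite cnorm_expi. Qed.

Lemma cnorm_cauchy_le z t : inD z -> cnorm (q z t) <= (1 - cnorm z)^-1.
Proof.
move=> zD; rewrite cnormV lef_pV2 ?posrE ?cnorm_gt0 ?subr1_neq0 ?subr_gt0 //; last exact: wD.
by apply: le_trans (lerB_cnorm _ _); rewrite cnorm1 cnormM cnorm_expi mul1r.
Qed.

Lemma cmeas_expiN (D : set R) : cmeas D (fun t => expi (- t) : R[i]).
Proof. by under eq_fun do rewrite -mulN1r; exact: cmeas_expi. Qed.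

Lemma cbmeas_expiN (D : set R) : cbmeas D (fun t => expi (- t) : R[i]).
Proof. by split; [exact: cmeas_expiN|exists 1 => t _; rewrite cnorm_expi]. Qed.

Lemma cbmeas_cauchy z : inD z -> cbmeas T0 (q z).
Proof.
move=> zD; split; last by exists (1 - cnorm z)^-1 => t _; exact: cnorm_cauchy_le.
apply: cmeas_cvg (fun t _ => ccvg_geometric (wD t zD)) => n.
have : cbmeas T0 (fun t => \sum_(k < n) (expi (- t) * z) ^+ k).
  by apply: cbmeas_sum => k; apply: cbmeasX; apply: cbmeasM; [exact: cbmeas_expiN|exact: cbmeas_cst].
by case.
Qed.

Definition cauchy_transform z := cint mu T0 (q z).

Definition clark_function z : R[i] := (1 - (alpha^*)%C * phi z)^-1.

Let phiD z : inD z -> inD ((alpha^*)%C * phi z).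
Proof. by move=> zD; apply: inD_rot; [rewrite cnormJ|apply: phi_self.2]. Qed.

Lemma Re_clark_function z : inD z ->
  Re (clark_function z - cauchy_transform z) = (1 - fine (mu T0)) / 2.
Proof.
move=> zD; have [_ /(_ z zD)] := clark.
have pE t : poisson z t = 2 * Re (q z t) - 1.
  rewrite -half_plane_identity ?inD_neq1 //; last exact: wD.
  rewrite /poisson cnormM cnorm_expi mul1r; congr (_ / _ ^+ 2).
  by rewrite -[LHS]mul1r -{1}(cnorm_expi (- t)) -cnormM mulrBr -expiD addNr expi0.
have -> : (1 - cnorm (phi z) ^+ 2) / cnorm (alpha - phi z) ^+ 2 =
    2 * Re (clark_function z) - 1.
  rewrite -half_plane_identity ?inD_neq1 //; last exact: phiD.
  rewrite cnormM cnormJ alpha1 mul1r; congr (_ / _ ^+ 2).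
  rewrite -[LHS]mul1r -{1}alpha1 -cnormJ -cnormM mulrBr [X in X - _]mulrC mul_conjc.
  by rewrite alpha1 expr1n.
have bq := cbmeas_cauchy zD.
have iq := integrable_Re mT0 clark_fin bq.
have -> : (\int[mu]_(t in T0) (poisson z t)%:E)%E =
    (2 * Re (cauchy_transform z) - fine (mu T0))%:E.
  have i2 : mu.-integrable T0 (EFin \o (fun t => 2 * Re (q z t))).
    by have := integrableZl mT0 2 iq.
  have i1 : mu.-integrable T0 (EFin \o (fun=> 1 : R)).
    by apply: (bounded_integrable mT0 clark_fin (M := `|1|)) => //; exact: measurable_cst.
  transitivity (\int[mu]_(t in T0) (2 * Re (q z t) - 1))%:E.
    rewrite /Rintegral fineK; first by apply: eq_integral => t _; rewrite pE.
    by apply: integrable_fin_num => //; exact: (integrableB mT0 i2 i1).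
  by rewrite RintegralB // RintegralZl // Rintegral_cst // mul1r.
by move=> E; have {}E := EFin_inj E; rewrite cReB; lra.
Qed.

(** Differentiation under the integral sign with an exact remainder. Both [z] and [z + h] have
    modulus at most [1 - eta], so each of the three Cauchy kernels in the remainder is at most
    [eta^-1]; the factor 2 comes from [cnorm_cint_le]. *)
Lemma cdiff_cauchy_transform z : inD z -> exists L, cdiff cauchy_transform z L.
Proof.
move=> zD; pose eta := (1 - cnorm z) / 2.
have z1 : cnorm z < 1 by [].
have eta0 : 0 < eta by rewrite /eta; lra.
pose L := cint mu T0 (fun t => expi (- t) * (q z t * q z t)).
exists L; apply: (cdiff_taylor eta0 (C := 2 * (eta^-1 ^+ 3) * fine (mu T0))) => h he.
have hz : cnorm (z + h) <= 1 - eta.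
  by apply: le_trans (cnormD _ _) _; rewrite /eta in he *; lra.
have zhD : inD (z + h) by apply: le_lt_trans hz _; lra.
have bE := cbmeas_expiN T0.
have bq := cbmeas_cauchy zD; have bqh := cbmeas_cauchy zhD.
have bqq : cbmeas T0 (fun t => expi (- t) * (q z t * q z t)).
  by apply: cbmeasM => //; exact: cbmeasM.
have bQ : cbmeas T0 (fun t => expi (- t) * expi (- t) * (q z t * q z t * q (z + h) t)).
  by apply: cbmeasM; apply: cbmeasM => //; apply: cbmeasM.
have -> : cauchy_transform (z + h) - cauchy_transform z - h * L =
    h ^+ 2 * cint mu T0 (fun t => expi (- t) * expi (- t) * (q z t * q z t * q (z + h) t)).
  rewrite /L -!cintZ //; try exact: clark_fin.
  rewrite -!cintN //; try exact: clark_fin; last by apply: cbmeasM => //; exact: cbmeas_cst.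
  have bh : cbmeas T0 (fun t => h * (expi (- t) * (q z t * q z t))).
    by apply: cbmeasM => //; exact: cbmeas_cst.
  rewrite -!cintD //; try exact: clark_fin; try (by apply: cbmeasN);
    last by apply: cbmeasD => //; exact: cbmeasN.
  apply: eq_cint => t _; rewrite /q.
  have n1 := subr1_neq0 (wD t zD); have n2 := subr1_neq0 (wD t zhD).
  by field; rewrite n1 n2.
rewrite cnormM cnormX [leRHS]mulrC ler_wpM2l ?exprn_ge0 ?cnorm_ge0 //.
apply: cnorm_cint_le => //; first exact: clark_fin; first by case: bQ.
move=> t _; rewrite !cnormM !cnorm_expi !mul1r.
have q1 w : cnorm w <= 1 - eta -> cnorm (q w t) <= eta^-1.
  move=> we; apply: le_trans (cnorm_cauchy_le t _) _; first by rewrite /inD; lra.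
  by rewrite lef_pV2 ?posrE //; lra.
rewrite exprSr expr2; apply: ler_pM; rewrite ?mulr_ge0 ?cnorm_ge0 ?q1 //.
by apply: ler_pM; rewrite ?cnorm_ge0 ?q1 //; rewrite /eta; lra.
Qed.

Lemma clark_function_eq z : inD z ->
  clark_function z = cauchy_transform z + (clark_function 0 - cauchy_transform 0).
Proof.
move=> zD; apply/eqP; rewrite addrC -subr_eq; apply/eqP.
apply: (@cdiff_const _ (fun w => clark_function w - cauchy_transform w)
  ((1 - fine (mu T0)) / 2)) => // w wD'; last exact: Re_clark_function.
have [L cL] := cdiff_cauchy_transform wD'.
have [/analytic_isps[a pa] _] := phi_self.
have [L' cL'] := isps_cdiff pa wD'.
have := cdiff_inv1B cL' wD' (fun w h => subr1_neq0 (phiD h)) => cV.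
by exists (((alpha^*)%C * L' / (1 - (alpha^*)%C * phi w) / (1 - (alpha^*)%C * phi w)) - L); exact: cdiffB.
Qed.

(** After multiplication by [1 - expi (- s) * z n] the Cauchy kernel tends pointwise to the
    indicator of [s], and the nontangential hypothesis bounds it by [M]; this is what dominated
    convergence requires. The additive constant [kappa] is multiplied by a factor tending to 0. *)
Lemma clark_point_mass s (z : nat -> R[i]) (M : R) : T0 s ->
  (forall n, inD (z n)) -> ccvg \oo z (expi s) ->
  (forall n, cnorm (1 - expi (- s) * z n) <= M * (1 - cnorm (z n))) ->
  ccvg \oo (fun n => (1 - expi (- s) * z n) * clark_function (z n))
    (fine (mu [set s]))%:C%C.
Proof.
move=> Ts zD zs zM.
have num0 : ccvg \oo (fun n => 1 - expi (- s) * z n) 0.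
  rewrite -[X in ccvg _ _ X](subrr 1) -[X in ccvg _ _ (1 - X)]expi0 -(addNr s) expiD.
  by apply: ccvgB (ccvg_cst 1) (ccvgM (ccvg_cst _) zs).
set kappa := clark_function 0 - cauchy_transform 0.
have -> : (fine (mu [set s]))%:C%C = (fine (mu [set s]))%:C%C + 0 * kappa by rewrite mul0r addr0.
apply: near_ccvg (ccvgD (f := fun n => cint mu T0 (fun t => (1 - expi (- s) * z n) * q (z n) t)) _
    (ccvgM num0 (ccvg_cst kappa))).
  apply: nearW => n; rewrite clark_function_eq // -/kappa [RHS]mulrDr; congr (_ + _).
  by apply: cintZ; [exact: mT0|exact: clark_fin|exact: cbmeas_cauchy].

have -> : (fine (mu [set s]))%:C%C = cint mu T0 (fun t => (\1_[set s] t : R)%:C%C).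
  rewrite /cint /= Rintegral_cst // mul0r; congr Complex.
  rewrite /Rintegral integral_indic //; congr fine; congr (mu _).
  by apply/seteqP; split => [x -> //|x []].
apply: (cint_cvg mT0 clark_fin (M := M)) => [n|n t _|t Tt].
- have [] // : cbmeas T0 (fun t => (1 - expi (- s) * z n) * q (z n) t).
  by apply: cbmeasM; [exact: cbmeas_cst|exact: cbmeas_cauchy].
- rewrite cnormM; have z1 : 0 < 1 - cnorm (z n) by rewrite subr_gt0; exact: zD.
  apply: (@le_trans _ _ (M * (1 - cnorm (z n)) * (1 - cnorm (z n))^-1)).
    by apply: ler_pM; rewrite ?cnorm_ge0 ?zM ?cnorm_cauchy_le.
  by rewrite mulfK // gt_eqF.
- have [->|ts] := eqVneq t s.
    rewrite indicE mem_set //; apply: near_ccvg (ccvg_cst _); apply: nearW => n.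
    by rewrite /q divff // subr1_neq0 //; exact: wD.
  rewrite indicE memNset /=; last by move=> e; rewrite e eqxx in ts.
  rewrite -[X in ccvg _ _ X](mul0r (1 - expi (- t) * expi s)^-1).
  apply: ccvgM => //; apply: ccvgV; last by apply: ccvgB (ccvg_cst 1) (ccvgM (ccvg_cst _) zs).
  rewrite subr_eq0; apply: contra ts => /eqP e.
  have := congr1 (fun x => expi t * x) e; rewrite mulr1 mulrA -expiD subrr expi0 mul1r => e'.
  by apply/eqP/expi_inj => //; move: Tt Ts; rewrite /= !in_itv.
Qed.

End ClarkMeasure.

(** * Stolz approach points, truncated kernels, and the limits of the test quantities *)

Section TestFunctions.
Variable R : realType.
Implicit Types (z w zeta : R[i]) (x eps s : R).

(* The approach direction: points [zeta (1 - x kappa)] tend to [zeta] inside a Stolz angle,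
   the more tangentially the larger [M] is. *)
Definition slope (M : R) : R[i] := (1 +i* M)%C.

Definition stolz (M : R) zeta x : R[i] := zeta * (1 - x%:C%C * slope M).

Section Stolz.
Variables (M : R) (zeta : R[i]).
Hypothesis zeta1 : cnorm zeta = 1.

Lemma sqr_cnorm_stolz x :
  cnorm (stolz M zeta x) ^+ 2 = 1 - x * (2 - x * (1 + M ^+ 2)).
Proof. by rewrite cnormM zeta1 mul1r sqr_cnorm /=; ring. Qed.

Variable x : R.
Hypotheses (x0 : 0 < x) (xM : x * (1 + M ^+ 2) <= 1).

Lemma sqr_cnorm_stolz_le : cnorm (stolz M zeta x) ^+ 2 <= 1 - x.
Proof. by rewrite sqr_cnorm_stolz lerD2l lerN2 ler_peMr ?(ltW x0) // lerBrDr -[2]/(1 + 1) lerD2l. Qed.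

Lemma inD_stolz : inD (stolz M zeta x).
Proof.
rewrite /inD -(@ltr_pXn2r _ 2) ?nnegrE ?cnorm_ge0 // expr1n.
by apply: le_lt_trans sqr_cnorm_stolz_le _; rewrite ltrBlDr ltrDl.
Qed.

Lemma gap_stolz : gap (stolz M zeta x) = Num.sqrt (x * (2 - x * (1 + M ^+ 2))).
Proof. by rewrite /gap sqr_cnorm_stolz; congr Num.sqrt; ring. Qed.

Lemma stolz_distance : 1 - (zeta^*)%C * stolz M zeta x = x%:C%C * slope M.
Proof.
have e : (zeta^*)%C * zeta = 1 by rewrite mulrC mul_conjc zeta1 expr1n.
by rewrite /stolz mulrA e mul1r opprB addrCA subrr addr0.
Qed.

(** With [r] the modulus of the point, [x <= 1 - r ^+ 2 <= 2 * (1 - r)]; hence the factor 2. *)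
Lemma stolz_nontangential : cnorm (1 - (zeta^*)%C * stolz M zeta x) <=
  2 * cnorm (slope M) * (1 - cnorm (stolz M zeta x)).
Proof.
rewrite stolz_distance cnormM cnormR ger0_norm ?(ltW x0) //.
rewrite [leRHS](_ : _ = (2 * (1 - cnorm (stolz M zeta x))) * cnorm (slope M)); last by ring.
rewrite ler_wpM2r ?cnorm_ge0 //.
have := sqr_cnorm_stolz_le; have := inD_stolz; rewrite /inD.
have := cnorm_ge0 (stolz M zeta x); set r := cnorm _ => r0 r1 r2.
have : 0 <= (1 - r) ^+ 2 by exact: sqr_ge0.
rewrite sqrrB expr1n mul1r mulr2n => H; lra.
Qed.

End Stolz.

Lemma cvg_gap_stolz M zeta (u : nat -> R) : cnorm zeta = 1 ->
  u n @[n --> \oo] --> (0 : R) -> gap (stolz M zeta (u n)) @[n --> \oo] --> (0 : R).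
Proof.
move=> z1 u0; have -> : (fun n => gap (stolz M zeta (u n))) =
    (fun n => Num.sqrt (u n * (2 - u n * (1 + M ^+ 2)))).
  by apply/funext => n; rewrite gap_stolz.
rewrite -[X in _ --> X](@sqrtr0 R); apply: cvg_sqrt.
have -> : (0 : R) = 0 * (2 - 0 * (1 + M ^+ 2)) by rewrite mul0r.
apply: cvgM => //; apply: cvgB; first exact: cvg_cst.
by apply: cvgM => //; exact: cvg_cst.
Qed.

Lemma ccvg_stolz M zeta (u : nat -> R) :
  u n @[n --> \oo] --> (0 : R) -> ccvg \oo (fun n => stolz M zeta (u n)) zeta.
Proof.
move=> u0; rewrite -[X in ccvg _ _ X]mulr1; apply: ccvgM; first exact: ccvg_cst.
rewrite -[X in ccvg _ _ X](subr0 1) -[X in ccvg _ _ (1 - X)](mul0r (slope M)).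
apply: ccvgB (ccvg_cst 1) _; apply: ccvgM (ccvg_cst _).
exact: ccvg_real.
Qed.

(* Taylor polynomial of the normalized reproducing kernel at [w]. *)
Definition kernel_coef w (j : nat) : R[i] := (gap w)%:C%C * ((w^*)%C) ^+ j.

Definition kernel_poly w N (u : R[i]) : R[i] := \sum_(j < N) kernel_coef w j * u ^+ j.

Lemma kernel_poly_H2 w N : inD w -> is_H2 (kernel_poly w N) /\ H2norm (kernel_poly w N) <= 1.
Proof.
move=> wD; have [|p2 p1] := @is_H2P _ _ _ 1 (isps_poly (kernel_coef w) N).
  move=> n; have w2 : 0 <= cnorm w ^+ 2 < 1 by rewrite sqr_ge0 cnorm_sqr_lt1.
  apply: (@le_trans _ _ (gap w ^+ 2 * \sum_(k < n) (cnorm w ^+ 2) ^+ k)).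
    rewrite mulr_sumr; apply: ler_sum => k _.
    case: ifP => _; last by rewrite cnorm0 expr0n mulr_ge0 ?sqr_ge0 // exprn_ge0 ?sqr_ge0.
    by rewrite cnormM cnormX cnormJ cnormR exprMn ger0_norm ?gap_ge0 // -!exprM mulnC.
  apply: le_trans (ler_wpM2l (sqr_ge0 _) (geometric_sum_le n w2)) _.
  by rewrite -sqr_gap // divff // expf_neq0 // gt_eqF // sqrtr_gt0 subr_gt0 cnorm_sqr_lt1.
split => //; rewrite -(@ler_pXn2r _ 2) ?nnegrE ?H2norm_ge0 ?ler01 //.
by rewrite expr1n.
Qed.

(** Only membership is at stake: a polynomial in [phi] is bounded on the disc by the sum of the
    moduli of its coefficients. *)
Lemma kernel_poly_comp_H2 phi w N : analytic_selfmap phi -> inD w ->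
  is_H2 (fun z => kernel_poly w N (phi z)).
Proof.
move=> [aphi sphi] wD; have [a pa] := analytic_poly_comp (kernel_coef w) N aphi.
split; first by apply/analytic_isps; exists a.
apply: (le_lt_trans (H2norm2_le_sup (B := \sum_(j < N) cnorm (kernel_coef w j)) pa _)).
  move=> z zD; apply: le_trans (cnorm_sum _ _ _) _; apply: ler_sum => j _.
  by rewrite cnormM cnormX ler_piMr ?cnorm_ge0 // exprn_ile1 ?cnorm_ge0 // ltW // sphi.
exact: ltry.
Qed.

Lemma kernel_polyE w N (u : R[i]) : inD w -> inD u ->
  kernel_poly w N u = (gap w)%:C%C / (1 - (w^*)%C * u) * (1 - ((w^*)%C * u) ^+ N).
Proof.
move=> wD uD; have wuD : inD ((w^*)%C * u).
  by rewrite /inD cnormM cnormJ mulr_ilt1 ?cnorm_ge0.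
have n0 := subr1_neq0 wuD.
have -> : kernel_poly w N u = (gap w)%:C%C * \sum_(j < N) ((w^*)%C * u) ^+ j.
  by rewrite mulr_sumr; apply: eq_bigr => j _; rewrite /kernel_coef exprMn mulrA.
rewrite -mulrA; congr (_ * _); apply: (mulfI n0).
by rewrite [RHS]mulrA divff // mul1r -[RHS]opprB subrX1 -[RHS]mulNr opprB.
Qed.

Section Limit.
Variables (phi : R[i] -> R[i]) (alpha : R[i]) (mu : {measure set R -> \bar R}).
Hypotheses (phi_self : analytic_selfmap phi) (alpha1 : cnorm alpha = 1)
  (clark : is_clark_measure phi alpha mu).
Variables (M c s : R) (eps : nat -> R) (N : nat -> nat).
Hypotheses (c0 : 0 < c) (Ts : 0 <= s < 2 * pi) (eps0 : forall n, 0 < eps n)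
  (epsM : forall n, eps n * (1 + M ^+ 2) <= 1)
  (cepsM : forall n, (c * eps n) * (1 + M ^+ 2) <= 1)
  (eps_cvg : eps n @[n --> \oo] --> (0 : R)).

Let kappa := slope M.
Let w n := stolz M alpha (eps n).
Let z n := stolz M (expi s) (c * eps n).
Let d := fine (mu [set s]).

(** The degree must outrun the approach of [w n] to the circle, so that the truncation factor in
    [kernel_polyE] tends to 1. *)
Hypothesis wN : forall n, cnorm (w n) ^+ N n <= n.+1%:R^-1.

Let ceps0 n : 0 < c * eps n. Proof. exact: mulr_gt0. Qed.
Let wD n : inD (w n). Proof. exact: inD_stolz. Qed.
Let zD n : inD (z n). Proof. exact (inD_stolz (cnorm_expi s) (ceps0 n) (cepsM n)). Qed.

Let ceps_cvg : c * eps n @[n --> \oo] --> (0 : R).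
Proof. by rewrite -[X in _ --> X](mulr0 c); apply: cvgM => //; exact: cvg_cst. Qed.

Let kappa_neq0 : kappa != 0.
Proof. by apply/eqP => -[] /eqP; rewrite oner_eq0. Qed.

Let d0 : 0 <= d. Proof. exact: fine_ge0. Qed.

Let V n := clark_function phi alpha (z n).

(** This is [clark_point_mass] along [z n], where the distance factor equals [c * eps n * kappa]. *)
Let epsV : ccvg \oo (fun n => (eps n)%:C%C * V n) ((d / c)%:C%C / kappa).
Proof.
have Ts' : (`[0%R, (2 * pi)%R[%classic : set R) s by rewrite /mkset in_itv.
have nt n : cnorm (1 - expi (- s) * z n) <= 2 * cnorm kappa * (1 - cnorm (z n)).
  by rewrite -conj_expi; apply: stolz_nontangential => //; exact: cnorm_expi.
have H : ccvg \oo (fun n => (c * eps n)%:C%C * kappa * V n) d%:C%C.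
  apply: near_ccvg (clark_point_mass phi_self alpha1 clark Ts' zD (ccvg_stolz M _ ceps_cvg) nt).
  by apply: nearW => n; rewrite -conj_expi stolz_distance // cnorm_expi.
have -> : (d / c)%:C%C / kappa = d%:C%C * ((c^-1)%:C%C / kappa).
  by rewrite rmorphM /= mulrA.
apply: near_ccvg (ccvgM H (ccvg_cst _)); apply: nearW => n.
have cn0 : c%:C%C != 0 :> R[i] by rewrite -cnorm_eq0 cnormR normr_eq0 gt_eqF.
rewrite rmorphM /= fmorphV /=.
by field; rewrite kappa_neq0 cn0.
Qed.

Let rho := d / c.

Let rho0 : 0 <= rho. Proof. by rewrite divr_ge0 // ltW. Qed.

Let den_neq0 : (kappa^*)%C * rho%:C%C + kappa != 0.
Proof.
apply/eqP => /(congr1 Re) /=; rewrite mul1r mulr0 subr0 => H.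
by have : 0 < rho + 1 := ltr_wpDl rho0 ltr01; rewrite H ltxx.
Qed.

Let kernel_cvg :
  ccvg \oo (fun n => (eps n)%:C%C / (1 - ((w n)^*)%C * phi (z n)))
    (rho%:C%C / ((kappa^*)%C * rho%:C%C + kappa)).
Proof.
have -> : rho%:C%C / ((kappa^*)%C * rho%:C%C + kappa) =
    (rho%:C%C / kappa) / ((kappa^*)%C * (rho%:C%C / kappa) + (1 - 0 * (kappa^*)%C)).
  by rewrite mul0r subr0; field; rewrite den_neq0 kappa_neq0.
have den : (kappa^*)%C * (rho%:C%C / kappa) + (1 - 0 * (kappa^*)%C) != 0.
  rewrite mul0r subr0 (_ : _ + 1 = ((kappa^*)%C * rho%:C%C + kappa) / kappa).
    by rewrite mulf_neq0 // invr_neq0.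
  by field.
have epsC : ccvg \oo (fun n => (eps n)%:C%C) 0 by exact: ccvg_real.
apply: near_ccvg (ccvgM epsV (ccvgV den (ccvgD (ccvgM (ccvg_cst _) epsV)
  (ccvgB (ccvg_cst 1) (ccvgM epsC (ccvg_cst (kappa^*)%C)))))).
apply: nearW => n; rewrite /V /clark_function /w /stolz cconjM.
have pD : inD ((alpha^*)%C * phi (z n)).
  by apply: inD_rot; [rewrite cnormJ|exact: phi_self.2].
have n1 := subr1_neq0 pD.
have n2 : 1 - ((w n)^*)%C * phi (z n) != 0.
  by apply: subr1_neq0; rewrite /inD cnormM cnormJ mulr_ilt1 ?cnorm_ge0 //; [exact: wD|exact: phi_self.2].
have wE : ((1 - (eps n)%:C%C * slope M)^*)%C = 1 - (eps n)%:C%C * (kappa^*)%C.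
  by apply: complex_ext => /=; ring.
move: n2; rewrite /w /stolz cconjM wE mulrAC.
set p := (alpha^*)%C * phi (z n) in n1 *; set e := (eps n)%:C%C; set k := (kappa^*)%C => n2.
(* Since [p / (1 - p) = 1 / (1 - p) - 1], the denominator divided by [1 - p] depends only on [e] and
   on [e * V], both of known limit. *)
have -> : k * (e * (1 - p)^-1) + (1 - e * k) = (1 - p * (1 - e * k)) / (1 - p) by field.
rewrite invfM invrK mulrACA [X in _ * X]mulrC mulrA.
by field; rewrite n2 n1.
Qed.

Lemma test_function_limit :
  ccvg \oo (fun n => (gap (z n))%:C%C * kernel_poly (w n) (N n) (phi (z n)))
    ((2 * Num.sqrt c)%:C%C * (rho%:C%C / ((kappa^*)%C * rho%:C%C + kappa))).
Proof.
(* The two gaps behave like the square roots of [2 c eps] and [2 eps]; their product is [eps] times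
   a factor tending to [2 * Num.sqrt c], and this [eps] is the numerator in [kernel_cvg]. *)
pose G n := Num.sqrt (c * (2 - (c * eps n) * (1 + M ^+ 2)) * (2 - eps n * (1 + M ^+ 2))).
have gapG n : gap (z n) * gap (w n) = G n * eps n.
  rewrite /z /w !gap_stolz ?cnorm_expi //.
  rewrite -sqrtrM; last by rewrite mulr_ge0 ?(ltW (ceps0 n)) //; have := cepsM n; lra.
  rewrite -[X in _ = _ * X](ger0_norm (ltW (eps0 n))) -sqrtr_sqr -sqrtrM.
    by congr Num.sqrt; ring.
  apply: mulr_ge0; last by have := epsM n; lra.
  by apply: mulr_ge0; [exact: ltW|have := cepsM n; lra].
have cG : G n @[n --> \oo] --> 2 * Num.sqrt c.
  have -> : 2 * Num.sqrt c = Num.sqrt (c * (2 - 0 * (1 + M ^+ 2)) * (2 - 0 * (1 + M ^+ 2))).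
    have -> : 2 - 0 * (1 + M ^+ 2) = 2 by rewrite mul0r subr0.
    have -> : c * 2 * 2 = 2 ^+ 2 * c by ring.
    by rewrite sqrtrM ?sqr_ge0 // sqrtr_sqr ger0_norm.
  rewrite /G; apply: cvg_sqrt.
  apply: cvgM.
    apply: cvgM; first exact: cvg_cst.
    by apply: cvgB; [exact: cvg_cst|apply: cvgM => //; exact: cvg_cst].
  by apply: cvgB; [exact: cvg_cst|apply: cvgM => //; exact: cvg_cst].
have ctail : ccvg \oo (fun n => 1 - (((w n)^*)%C * phi (z n)) ^+ N n) 1.
  rewrite -[X in ccvg _ _ X](subr0 1); apply: ccvgB; first exact: ccvg_cst.
  apply: (ccvg_squeeze (u := fun n => n.+1%:R^-1 : R)); last exact: cvg_harmonic.
  apply: nearW => n; rewrite subr0 cnormX cnormM cnormJ.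
  apply: le_trans (wN n); rewrite lerXn2r ?nnegrE ?mulr_ge0 ?cnorm_ge0 //.
  by rewrite ler_piMr ?cnorm_ge0 // ltW //; exact: phi_self.2.
rewrite -[X in ccvg _ _ X]mulr1.
apply: near_ccvg (ccvgM (ccvgM (ccvg_real cG) kernel_cvg) ctail); apply: nearW => n.
rewrite kernel_polyE //; last exact: phi_self.2.
rewrite !mulrA; congr (_ * _); congr (_ / _).
by rewrite -!rmorphM /= gapG.
Qed.

End Limit.

End TestFunctions.

(** * From finite sets of atoms to the measure of a set all of whose points are atoms *)

Section Atoms.
Variables (R : realType) (mu : {measure set R -> \bar R}).

Lemma measure_uniq_seq (s : seq R) : uniq s ->
  mu [set` s] = (\sum_(t <- s) mu [set t])%E.
Proof.
elim: s => [_|t s IH /= /andP[ts us]].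
  have -> : [set` [::]] = set0 :> set R by apply/seteqP; split => x //=; rewrite in_nil.
  by rewrite big_nil measure0.
have -> : [set` t :: s] = [set t] `|` [set` s].
  apply/seteqP; split => x /=; rewrite in_cons; first by move/predU1P.
  by move=> H; apply/predU1P.
rewrite big_cons -IH // measureU //; last first.
  by apply/seteqP; split => // x [/= -> xs]; rewrite xs in ts.
apply: countable_measurable; first exact: measurable_set1.
by apply: finite_set_countable; apply/finite_seqP; exists s.
Qed.

(** [A] is the increasing union of the sets [F n] of atoms of mass at least [1 / (n + 1)]. Each is
    finite, so [A] turns out to be measurable, and continuity from below applies. *)
Lemma measure_atoms_le (A : set R) (S : R) :
  (forall t, A t -> (0 < mu [set t])%E) -> (forall t, A t -> (mu [set t] < +oo)%E) ->
  (forall s : seq R, uniq s -> (forall t, t \in s -> A t) ->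
     \sum_(t <- s) fine (mu [set t]) <= S) ->
  (mu A <= S%:E)%E.
Proof.
move=> A0 Ay AS.
have fin t : A t -> mu [set t] = (fine (mu [set t]))%:E.
  by move=> At; rewrite fineK // ge0_fin_numE ?Ay.
pose F n : set R := [set t | A t /\ n.+1%:R^-1 <= fine (mu [set t])].
(* More than [S * (n + 1)] atoms of mass at least [1 / (n + 1)] would have total mass above [S]. *)
have F_fin n : finite_set (F n).
  apply: contrapT => /infinite_set_fset H.
  have [B BF nB] := H (Num.truncn (S * n.+1%:R)).+1.
  have := AS (finmap.enum_fset B) (finmap.fset_uniq B) (fun t tB => (BF t tB).1).
  apply/negP; rewrite -ltNge.
  apply: (@lt_le_trans _ _ (\sum_(t <- finmap.enum_fset B) n.+1%:R^-1)); last first.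
    by rewrite big_seq [leRHS]big_seq; apply: ler_sum => t tB; case: (BF t tB).
  rewrite big_const_seq count_predT iter_addr_0 -[X in _ < X]mulr_natl ltr_pdivlMr ?ltr0n //.
  by apply: lt_le_trans (truncnS_gt _) _; rewrite ler_nat.
have FE n : (mu (F n) <= S%:E)%E.
  have /finite_seqP[s0 s0E] := F_fin n.
  have us : uniq (undup s0) by exact: undup_uniq.
  have sE : F n = [set` undup s0].
    by rewrite s0E; apply/seteqP; split => t /=; rewrite mem_undup.
  have sA t : t \in undup s0 -> A t.
    by move=> ts; have : F n t by [rewrite sE]; case.
  rewrite sE measure_uniq_seq //.
  apply: (@le_trans _ _ (\sum_(t <- undup s0) fine (mu [set t]))%:E).
    rewrite -sumEFin big_seq [leRHS]big_seq; apply: lee_sum => t ts.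
    by rewrite -fin //; exact: sA.
  by rewrite lee_fin; exact: AS.
have mF n : measurable (F n).
  by apply: countable_measurable; [exact: measurable_set1|exact: finite_set_countable].
have AE : A = \bigcup_n F n.
  apply/seteqP; split => [t At|t [n _ []]//].
  have c0 : 0 < fine (mu [set t]) by rewrite -lte_fin -fin // A0.
  exists (Num.truncn (fine (mu [set t]))^-1) => //; split => //.
  rewrite -[leRHS]invrK lef_pV2 ?posrE ?invr_gt0 ?ltr0n //.
  by rewrite ltW // truncnS_gt.
rewrite AE; apply: (cvge_to_le (nondecreasing_cvg_mu mF _ _)).
- exact: bigcup_measurable.
- move=> n p np; apply/subsetPset => t [At tn]; split => //.
  by apply: le_trans tn; rewrite lef_pV2 ?posrE ?ltr0n // ler_nat.
- by apply: nearW => n; exact: FE.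
Qed.

End Atoms.

(** * The lower bound for finitely many atoms and one compact perturbation *)

Section LowerBound.
Variable R : realType.
Implicit Types (M rho : R).

(** The imaginary part of the denominator is [M * (1 - rho)]. *)
Lemma slope_ratio_le M rho : 0 < M -> 0 <= rho -> rho != 1 ->
  cnorm (rho%:C%C / (((slope M)^*)%C * rho%:C%C + slope M)) <= rho / (M * `|1 - rho|).
Proof.
move=> M0 r0 r1; rewrite cnormM cnormV cnormR ger0_norm // ler_wpM2l //.
have p0 : 0 < M * `|1 - rho| by rewrite mulr_gt0 // normr_gt0 subr_eq0 eq_sym.
have h : M * `|1 - rho| <= cnorm (((slope M)^*)%C * rho%:C%C + slope M).
  apply: le_trans (Im_le_cnorm _).
  rewrite -[X in X * _](ger0_norm (ltW M0)) -normrM.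
  rewrite [Im _](_ : _ = M * (1 - rho)) //; rewrite cImD cImM /=; ring.
by rewrite lef_pV2 ?posrE // (lt_le_trans p0).
Qed.

Lemma slope_ratio1 M : 1 / (((slope M)^*)%C * 1 + slope M) = (2^-1)%:C%C :> R[i].
Proof.
have -> : ((slope M)^*)%C * 1 + slope M = (2 : R)%:C%C.
  by apply: complex_ext => /=; ring.
by rewrite div1r fmorphV.
Qed.

Lemma increasing_cvg_oo (sigma : nat -> nat) :
  (forall n, (sigma n < sigma n.+1)%N) -> sigma n @[n --> \oo] --> \oo.
Proof.
move=> s_inc; have ge n : (n <= sigma n)%N.
  by elim: n => // n IH; apply: leq_ltn_trans IH (s_inc n).
by move=> P [N _ NP]; exists N => // n /= Nn; apply: NP => /=; exact: leq_trans (ge n).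
Qed.

Variables (phi psi : R[i] -> R[i]) (alpha : R[i]) (mu nu : {measure set R -> \bar R}).
Hypotheses (phi_self : analytic_selfmap phi) (psi_self : analytic_selfmap psi)
  (alpha1 : cnorm alpha = 1)
  (clark_phi : is_clark_measure phi alpha mu) (clark_psi : is_clark_measure psi alpha nu).

Let T : op R := fun f w => comp_op phi f w - comp_op psi f w.

Variables (K : op R) (B : R).
Hypotheses (K_compact : compact_op K)
  (TKB : (opnorm (fun f w => (T f w - K f w)%R) <= B%:E)%E).
Variables (m : nat) (s : 'I_m -> R).
Let c i := fine (mu [set s i]).
Let d i := fine (nu [set s i]).
Hypotheses (s_inj : injective s) (sT : forall i, 0 <= s i < 2 * pi)
  (c_gt0 : forall i, 0 < c i) (cd : forall i, d i != c i).

Let rho i := d i / c i.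

Let rho_ge0 i : 0 <= rho i.
Proof. by rewrite divr_ge0 ?fine_ge0 // ltW. Qed.

Let rho_neq1 i : rho i != 1.
Proof.
apply: contra (cd i) => /eqP r1; apply/eqP; rewrite -[d i](divfK (_ : c i != 0)) ?gt_eqF //.
by rewrite -/(rho i) r1 mul1r.
Qed.

(** A fixed slope [M] leaves a residual contribution of [psi]; [eta] is its permitted share of
    [Num.sqrt (c i)]. *)
Lemma atoms_lower_bound_eta (eta : R) : 0 < eta < 1 ->
  (1 - eta) ^+ 2 * \sum_(i < m) c i <= B ^+ 2.
Proof.
move=> /andP[eta0 eta1].
(* Any [M >= a i] makes [2 * rho i / (M * |1 - rho i|)] at most [eta]. A sum serves as a common
   upper bound for all [i], here and in [E]. *)
pose a i := 2 * rho i / (eta * `|1 - rho i|).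
have a0 i : 0 <= a i.
  by apply: divr_ge0; apply: mulr_ge0 => //; exact: ltW.
pose M := 1 + \sum_(i < m) a i.
have M0 : 0 < M by rewrite ltr_pwDl // sumr_ge0.
have aM i : a i <= M by rewrite /M (bigD1 i) //= addrCA lerDl addr_ge0 // sumr_ge0.
(* Dividing by [E] keeps both steps, [eps n] and each [c i * eps n], small enough for the Stolz
   points to lie in the disc. *)
pose E := (1 + M ^+ 2) * (1 + \sum_(i < m) c i).
have c_ge0 i : 0 <= c i by exact: ltW.
have E1 : 1 + M ^+ 2 <= E by rewrite ler_peMr ?addr_ge0 ?sqr_ge0 // lerDl sumr_ge0.
have Ec i : c i * (1 + M ^+ 2) <= E.
  rewrite mulrC ler_wpM2l ?addr_ge0 ?sqr_ge0 // (bigD1 i) //= addrCA lerDl addr_ge0 //.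
  by rewrite sumr_ge0.
have E0 : 0 < E by apply: lt_le_trans E1; rewrite ltr_pwDl // sqr_ge0.
pose eps n : R := E^-1 * n.+1%:R^-1.
have eps0 n : 0 < eps n by rewrite mulr_gt0 ?invr_gt0 ?ltr0n.
have epsE n x : x <= E -> eps n * x <= 1.
  move=> xE; apply: (@le_trans _ _ (eps n * E)); first by rewrite ler_wpM2l // ltW.
  rewrite /eps mulrAC mulVf ?gt_eqF // mul1r invf_le1 ?ltr0n //.
  by rewrite ler1n.
have epsM n : eps n * (1 + M ^+ 2) <= 1 by exact: epsE.
have cepsM i n : c i * eps n * (1 + M ^+ 2) <= 1 by rewrite mulrC mulrA mulrC epsE // mulrC.
have eps_cvg : eps n @[n --> \oo] --> (0 : R).
  rewrite -[X in _ --> X](mulr0 E^-1); apply: cvgM; first exact: cvg_cst.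
  exact: cvg_harmonic.
pose w n := stolz M alpha (eps n).
have wD n : inD (w n) by exact: inD_stolz.
have [N wN] : {N : nat -> nat & forall n, cnorm (w n) ^+ N n <= n.+1%:R^-1}.
  apply: (@choice _ _ (fun n N => cnorm (w n) ^+ N <= n.+1%:R^-1)) => n.
  have w1 : `|cnorm (w n)| < 1 by rewrite ger0_norm ?cnorm_ge0 //; exact: wD.
  have n0 : 0 < n.+1%:R^-1 :> R by rewrite invr_gt0 ltr0n.
  have [N _ /(_ N (leqnn N))] := (cvgrPdist_le _ _).1 (cvg_expr w1) _ n0.
  by rewrite /= sub0r normrN ger0_norm ?exprn_ge0 ?cnorm_ge0 // => ?; exists N.
pose p n := kernel_poly (w n) (N n).
have pH2 n : is_H2 (p n) /\ H2norm (p n) <= 1 by exact: kernel_poly_H2.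
pose z i n := stolz M (expi (s i)) (c i * eps n).
have ceps0 i n : 0 < c i * eps n by exact: mulr_gt0.
have zD i n : inD (z i n).
  by apply: inD_stolz; [exact: cnorm_expi|exact: ceps0|exact: cepsM].
have ceps_cvg i : c i * eps n @[n --> \oo] --> (0 : R).
  by rewrite -[X in _ --> X](mulr0 (c i)); apply: cvgM => //; exact: cvg_cst.
have gap_cvg i : gap (z i n) @[n --> \oo] --> (0 : R).
  by apply: cvg_gap_stolz => //; exact: cnorm_expi.
have z_cvg i : ccvg \oo (z i) (expi (s i)) by exact: ccvg_stolz.
pose lam i : R[i] := (Num.sqrt (c i))%:C%C - (2 * Num.sqrt (c i))%:C%C *
  ((rho i)%:C%C / (((slope M)^*)%C * (rho i)%:C%C + slope M)).
have T_cvg i : ccvg \oo (fun n => (gap (z i n))%:C%C * (p n (phi (z i n)) - p n (psi (z i n)))) (lam i).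
  have h1 := test_function_limit phi_self alpha1 clark_phi (c_gt0 i) (sT i) eps0 epsM (cepsM i) eps_cvg wN.
  have h2 := test_function_limit psi_self alpha1 clark_psi (c_gt0 i) (sT i) eps0 epsM (cepsM i) eps_cvg wN.
  have h1' : ccvg \oo (fun n => (gap (z i n))%:C%C * p n (phi (z i n))) (Num.sqrt (c i))%:C%C.
    (* For [phi] the mass at [s i] is [c i] itself, so its ratio is 1 and the factor 2 cancels
       against [slope_ratio1]. *)
    have -> : (Num.sqrt (c i))%:C%C = (2 * Num.sqrt (c i))%:C%C *
      ((c i / c i)%:C%C / (((slope M)^*)%C * (c i / c i)%:C%C + slope M)).
      rewrite divff ?gt_eqF // rmorph1 slope_ratio1 -rmorphM /=; congr (_%:C%C).
      by rewrite mulrAC divff // mul1r.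
    exact: h1.
  apply: near_ccvg (ccvgB h1' h2); apply: nearW => n.
  by rewrite mulrBr.
have lam_ge i : (1 - eta) ^+ 2 * c i <= cnorm (lam i) ^+ 2.
  have sc : 0 <= Num.sqrt (c i) by exact: sqrtr_ge0.
  have -> : (1 - eta) ^+ 2 * c i = ((1 - eta) * Num.sqrt (c i)) ^+ 2.
    by rewrite exprMn sqr_sqrtr.
  rewrite lerXn2r ?nnegrE ?cnorm_ge0 ?mulr_ge0 ?subr_ge0 ?(ltW eta1) //.
  apply: le_trans (lerB_cnorm _ _); rewrite cnormM !cnormR !ger0_norm ?mulr_ge0 //.
  rewrite mulrBl mul1r lerD2l lerN2.
  have := slope_ratio_le M0 (rho_ge0 i) (rho_neq1 i).
  set x := cnorm _ => xle.
  have D0 : 0 < `|1 - rho i| by rewrite normr_gt0 subr_eq0 eq_sym.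
  have : 2 * x <= eta.
    apply: (@le_trans _ _ (2 * (rho i / (M * `|1 - rho i|)))); first by rewrite ler_wpM2l.
    have := aM i; rewrite /a ler_pdivrMr ?mulr_gt0 // => aMi.
    rewrite mulrA ler_pdivrMr ?mulr_gt0 //; apply: le_trans aMi _.
    by rewrite le_eqVlt; apply/orP; left; apply/eqP; ring.
  by move=> xe; rewrite mulrAC ler_wpM2r.
have [_ _ /(_ p pH2)] := K_compact.
move=> [sigma [s_inc [g [g2 Kg]]]].
have sig_oo := increasing_cvg_oo s_inc.
have KH2 n : is_H2 (K (p n)) by have [K2 _ _] := K_compact; apply: K2; case: (pH2 n).
pose h k u := (p (sigma k) (phi u) - p (sigma k) (psi u)) - K (p (sigma k)) u.
have h2 k : is_H2 (h k).
  by apply: is_H2B => //; apply: is_H2B; exact: kernel_poly_comp_H2.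
have hB k : H2norm (h k) <= B.
  rewrite -lee_fin; apply: le_trans TKB; apply: ereal_sup_ubound.
  by exists (p (sigma k)).
(* The image under [K] splits into the limit [g], which boundary decay removes, and a difference
   tending to 0 in norm, which [H2_pointwise] removes. *)
have h_cvg i : ccvg \oo (fun k => (gap (z i (sigma k)))%:C%C * h k (z i (sigma k))) (lam i).
  have c1 := ccvg_comp sig_oo (T_cvg i).
  have c2 : ccvg \oo (fun k => (gap (z i (sigma k)))%:C%C * g (z i (sigma k))) 0.
    apply/ccvg0; under eq_fun do rewrite cnormM cnormR ger0_norm ?gap_ge0 //.
    by apply: H2_boundary_decay => //; exact: cvg_comp sig_oo (gap_cvg i).
  have c3 : ccvg \oo (fun k => (gap (z i (sigma k)))%:C%C *
      (K (p (sigma k)) (z i (sigma k)) - g (z i (sigma k)))) 0.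
    apply: (ccvg_squeeze (u := fun k => H2norm (fun u => K (p (sigma k)) u - g u))) => //.
    apply: nearW => k; rewrite subr0 cnormM cnormR ger0_norm ?gap_ge0 //.
    by apply: (H2_pointwise (h := fun u => K (p (sigma k)) u - g u)) => //; exact: is_H2B.
  have -> : lam i = lam i - 0 - 0 by rewrite !subr0.
  apply: near_ccvg (ccvgB (ccvgB c1 c3) c2); apply: nearW => k.
  by rewrite /h /=; ring.
pose gram i j n := gap (z i n) * gap (z j n) * 2 / cnorm (1 - z i n * ((z j n)^*)%C).
have gram_cvg i j : i != j -> gram i j n @[n --> \oo] --> (0 : R).
  move=> ij; have nz : 1 - expi (s i) * ((expi (s j))^*)%C != 0.
    rewrite conj_expi subr_eq0; apply: contra ij => /eqP e.
    have e' : expi (s i) = expi (s j).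
      by rewrite -[LHS]mulr1 -expi0 -(addNr (s j)) expiD mulrA -e mul1r.
    by apply/eqP/s_inj/expi_inj.
  have -> : (0 : R) = 0 * 0 * 2 / cnorm (1 - expi (s i) * ((expi (s j))^*)%C) by rewrite !mul0r.
  apply: cvgM; first by apply: cvgM; [apply: cvgM|exact: cvg_cst].
  apply: cvgV; first by rewrite cnorm_eq0.
  by apply: ccvg_cnorm; apply: ccvgB (ccvg_cst 1) (ccvgM (z_cvg i) (ccvg_conj (z_cvg j))).
(* The sum dominates every off-diagonal entry. It tends to 0 because distinct limit points keep the
   denominators away from 0 while the gaps vanish. *)
pose delta n := \sum_(i < m) \sum_(j < m) (if i != j then gram i j n else 0).
have gram_ge0 i j n : 0 <= gram i j n.
  by rewrite /gram divr_ge0 ?cnorm_ge0 // !mulr_ge0 ?gap_ge0.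
have off_ge0 i j n : 0 <= (if i != j then gram i j n else 0) by case: ifP.
have delta_cvg : delta (sigma k) @[k --> \oo] --> (0 : R).
  suff dc : delta n @[n --> \oo] --> (0 : R) by exact: cvg_comp sig_oo dc.
  have sum0 : \sum_(i < m) \sum_(j < m) (0 : R) = 0.
    by rewrite big1 // => i _; rewrite big1.
  rewrite -[X in _ --> X]sum0.
  apply: cvg_rsum => i; apply: cvg_rsum => j.
  by case: (boolP (i != j)) => [/gram_cvg//|_]; exact: cvg_cst.
have bessel k : \sum_(i < m) cnorm ((gap (z i (sigma k)))%:C%C * h k (z i (sigma k))) ^+ 2 <=
    B ^+ 2 * (1 + m%:R * delta (sigma k)).
  have B0 : 0 <= B by apply: le_trans (hB k); exact: H2norm_ge0.
  have de0 : 0 <= delta (sigma k) by apply: sumr_ge0 => i _; apply: sumr_ge0.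
  apply: (@le_trans _ _ (H2norm (h k) ^+ 2 * (1 + m%:R * delta (sigma k)))); last first.
    rewrite ler_wpM2r ?addr_ge0 ?mulr_ge0 //.
    by rewrite lerXn2r ?nnegrE ?H2norm_ge0.
  under eq_bigr do rewrite cnormM cnormR ger0_norm ?gap_ge0 //.
  apply: (bessel_kernels (z := fun i => z i (sigma k))) => // i j ij.
  rewrite -/(gram i j (sigma k)) /delta (bigD1 i) //= (bigD1 j) //= ij -addrA lerDl.
  by rewrite addr_ge0 // sumr_ge0 // => i' _; rewrite sumr_ge0.
have lhs : \sum_(i < m) cnorm ((gap (z i (sigma k)))%:C%C * h k (z i (sigma k))) ^+ 2
    @[k --> \oo] --> \sum_(i < m) cnorm (lam i) ^+ 2.
  apply: cvg_rsum => i; rewrite [X in _ --> X]expr2; under eq_fun do rewrite expr2.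
  by apply: cvgM; exact: ccvg_cnorm.
have rhs : B ^+ 2 * (1 + m%:R * delta (sigma k)) @[k --> \oo] --> B ^+ 2.
  rewrite -[X in _ --> X]mulr1; apply: cvgM; first exact: cvg_cst.
  rewrite -[X in _ --> X]addr0; apply: cvgD; first exact: cvg_cst.
  by rewrite -[X in _ --> X](mulr0 m%:R); apply: cvgM => //; exact: cvg_cst.
apply: (@le_trans _ _ (\sum_(i < m) cnorm (lam i) ^+ 2)).
  by rewrite mulr_sumr; apply: ler_sum => i _; exact: lam_ge.
by apply: ler_cvg_to lhs rhs _; apply: nearW.
Qed.

Lemma atoms_lower_bound : \sum_(i < m) c i <= B ^+ 2.
Proof.
set S := \sum_(i < m) c i.
have -> : S = (1 - 0) * (1 - 0) * S by rewrite subr0 !mul1r.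
have H : (1 - eta) * (1 - eta) * S @[eta --> (0 : R)^'+] --> (1 - 0) * (1 - 0) * S.
  apply: cvg_at_right_filter; apply: cvgM; last exact: cvg_cst.
  by apply: cvgM; (apply: cvgB; [exact: cvg_cst|exact: cvg_id]).
apply: (cvgr_to_le H); near=> eta; rewrite -expr2; apply: atoms_lower_bound_eta; apply/andP; split.
  by near: eta; exact: nbhs_right_gt.
by near: eta; apply: nbhs_right_lt; exact: ltr01.
Unshelve. all: by end_near.
Qed.

End LowerBound.

(** * Passage to the essential norm and to the whole set of atoms *)

(** The zero function lies in the unit ball, so the supremum is taken over a nonempty set; this
    excludes the value [-oo] for the essential norm. *)
Lemma opnorm_ge0 (R : realType) (U : op R) : (0 <= opnorm U)%E.
Proof.
have z2 : is_H2 (fun=> 0 : R[i]) /\ H2norm (fun=> 0 : R[i]) ^+ 2 <= 0.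
  apply: is_H2P (isps_cst 0) _ => n; rewrite big1 // => k _.
  by case: ifP => _; rewrite cnorm0 expr0n.
apply: (@le_trans _ _ (H2norm (U (fun=> 0)))%:E); first by rewrite lee_fin H2norm_ge0.
apply: ereal_sup_ubound; exists (fun=> 0) => //=; split; first exact: z2.1.
by rewrite -(@ler_pXn2r _ 2) ?nnegrE ?H2norm_ge0 // (le_trans z2.2) // expr1n.
Qed.

Theorem theorem3p2 (R : realType) (phi psi : R[i] -> R[i]) (alpha : R[i])
    (tau_phi tau_psi : {measure set R -> \bar R}) :
  analytic_selfmap phi -> analytic_selfmap psi -> cnorm alpha = 1 ->
  is_clark_measure phi alpha tau_phi -> is_clark_measure psi alpha tau_psi ->
  let Z := [set t : R | 0 <= t < 2 * pi /\
              (0 < tau_phi [set t])%E /\ tau_phi [set t] <> tau_psi [set t]] in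
  let T : op R := fun f w => comp_op phi f w - comp_op psi f w in
  (tau_phi Z <= ess_norm T * ess_norm T)%E.
Proof.
move=> phi_self psi_self alpha1 clark_phi clark_psi.
pose Z := [set t : R | 0 <= t < 2 * pi /\
              (0 < tau_phi [set t])%E /\ tau_phi [set t] <> tau_psi [set t]].
pose T : op R := fun f w => comp_op phi f w - comp_op psi f w.
change (tau_phi Z <= ess_norm T * ess_norm T)%E.
(* [fine] sends an infinite mass to 0, so positivity and distinctness of the masses carry over to
   reals only once the atoms are known to be finite. *)
have atom_fin (phi' : R[i] -> R[i]) (tau : {measure set R -> \bar R}) t :
    is_clark_measure phi' alpha tau -> 0 <= t < 2 * pi -> (tau [set t] < +oo)%E.
  move=> ck tT; apply: le_lt_trans (clark_fin ck).
  by apply: le_measure; rewrite ?inE //= => x /= ->; rewrite in_itv.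
have bound (K : op R) (B : R) : compact_op K ->
    (opnorm (fun f w => (T f w - K f w)%R) <= B%:E)%E -> (tau_phi Z <= (B ^+ 2)%:E)%E.
  move=> Kc TKB; apply: measure_atoms_le => [t [_ []]//|t [tT _]|s us sZ].
    exact: (atom_fin _ _ _ clark_phi tT).
  rewrite (big_nth 0) big_mkord.
  have sZi (i : 'I_(size s)) : Z s`_i by apply: sZ; exact: mem_nth.
  apply: (atoms_lower_bound phi_self psi_self alpha1 clark_phi clark_psi Kc TKB
    (s := fun i : 'I_(size s) => s`_i)).
  - by move=> i j /eqP; rewrite nth_uniq // => /eqP /val_inj.
  - by move=> i; case: (sZi i).
  - move=> i; have [tT [t0 _]] := sZi i.
    by rewrite -lte_fin fineK // ge0_fin_numE // (atom_fin _ _ _ clark_phi).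
  - move=> i; have [tT [_ tne]] := sZi i; apply/eqP => e; apply: tne.
    rewrite -[LHS]fineK ?ge0_fin_numE // ?(atom_fin _ _ _ clark_phi) //.
    by rewrite -[RHS]fineK ?ge0_fin_numE // ?(atom_fin _ _ _ clark_psi) // e.
have ess_ge0 : (0 <= ess_norm T)%E.
  by apply: le_ereal_inf_tmp => _ [K _ <-]; exact: opnorm_ge0.
case eE : (ess_norm T) ess_ge0 => [e| |] // e0; last by rewrite mulyy leey.
rewrite -EFinM -expr2.
(* The infimum over compact operators may not be attained, hence the slack [del], which tends to 0
   at the end. *)
have near_e (del : R) : 0 < del -> (tau_phi Z <= ((e + del) ^+ 2)%:E)%E.
  move=> del0; have : (ess_norm T < (e + del)%:E)%E by rewrite eE lte_fin ltrDl.
  by move=> /ereal_inf_lt[_ [K Kc <-] /ltW TKB]; exact: bound Kc TKB.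
have tfin : tau_phi Z \is a fin_num.
  by rewrite ge0_fin_numE //; apply: le_lt_trans (near_e 1 ltr01) (ltry _).
rewrite -(fineK tfin) lee_fin.
have H : (e + del) * (e + del) @[del --> (0 : R)^'+] --> (e + 0) * (e + 0).
  by apply: cvg_at_right_filter; apply: cvgM; (apply: cvgD; [exact: cvg_cst|exact: cvg_id]).
rewrite expr2 -[e]addr0; apply: (cvgr_to_ge H); near=> del.
rewrite -lee_fin (fineK tfin) -expr2; apply: near_e.
by near: del; exact: nbhs_right_gt.
Unshelve. all: by end_near.
Qed.
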